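(* Let $\mathbf{x}=(x_1,\dots,x_n)$ be a nondegenerate $n$-periodic trajectory (that is, $\det\mathbf{H}\ne0$) of a discrete Lagrangian system on an $m$-dimensional manifold. Suppose that $\sigma(\mathbf{x})(-1)^{m+\operatorname{ind}\mathbf{H}}<0$. Then $\mathbf{x}$ is dynamically unstable: there is a real multiplier $\rho>1$.
   Context: $M$ is an $m$-dimensional manifold and $L$ a smooth function on $M\times M$. $B(x,y)=-\partial_1\partial_2L(x,y):T_xM\to T_y^*M$ (in local coordinates $-(\partial^2L/\partial y_j\partial x_i)$) is assumed nondegenerate (it suffices near the trajectory). The discrete Lagrangian system is the locally defined map $T(x,y)=(y,z)$, $\partial_2L(x,y)+\partial_1L(y,z)=0$. An $n$-periodic trajectory is $(x_i)_{i\in\mathbb{Z}}$, $x_{i+n}=x_i$, with $\partial_2L(x_{i-1},x_i)+\partial_1L(x_i,x_{i+1})=0$; equivalently $\mathbf{x}=(x_1,\dots,x_n)$ is a critical point of $\mathscr{A}(\mathbf{x})=\sum_{i=1}^nL(x_i,x_{i+1})$ ($x_{n+1}=x_1$) on $M^n$. $\mathbf{H}$ is the Hessian of $\mathscr{A}$ at $\mathbf{x}$ and $\operatorname{ind}\mathbf{H}$ its Morse index (number of negative eigenvalues of the quadratic form). $\sigma(\mathbf{x})=\operatorname{sign}\prod_{i=1}^n\det B(x_i,x_{i+1})$ (computed in local coordinates near each $x_i$; the result is independent of them). Multipliers are the eigenvalues of $P=D(T^n)(x_1,x_2)$. *)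

(* Defs.v *)
From HB Require Import structures.
From mathcomp Require Import all_boot all_order all_algebra.
From mathcomp Require Import polyrcf.
From mathcomp Require Import all_classical all_reals all_analysis.

Set Implicit Arguments.
Unset Strict Implicit.
Unset Printing Implicit Defensive.

Import Order.TTheory GRing.Theory Num.Theory.
Import numFieldNormedType.Exports.

Local Open Scope classical_set_scope.
Local Open Scope ring_scope.

(* On an open set [U] of a finite-dimensional space this is the usual class
   C^k: differentiability together with all directional derivatives being
   C^(k-1). *)
Fixpoint is_Ck (R : realType) (V W : normedModType R) (k : nat) (U : set V)
    (f : V -> W) : Prop :=
  if k is k'.+1 then
    (forall a, U a -> differentiable f a) /\
    (forall v, is_Ck k' U (fun a => 'D_v f a))
  else forall a, U a -> {for a, continuous f}.

Definition smooth_on (R : realType) (V W : normedModType R) (U : set V)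
    (f : V -> W) : Prop :=
  forall k, is_Ck k U f.

(* [chart_inv] is total; only its values on [chart_im] are meaningful. *)
Record chart (R : realType) (m : nat) (M : topologicalType) := Chart {
  chart_dom : set M ;
  chart_map : M -> 'rV[R]_m ;
  chart_inv : 'rV[R]_m -> M ;
  chart_dom_open : open chart_dom ;
  chart_im_open : open (chart_map @` chart_dom) ;
  chart_mapK : forall x, chart_dom x -> chart_inv (chart_map x) = x ;
  chart_map_continuous : forall x, chart_dom x -> {for x, continuous chart_map} ;
  chart_inv_continuous :
    forall u, (chart_map @` chart_dom) u -> {for u, continuous chart_inv} }.

Definition chart_im (R : realType) (m : nat) (M : topologicalType)
  (c : chart R m M) : set 'rV[R]_m := chart_map c @` chart_dom c.

Definition smooth_compatible (R : realType) (m : nat) (M : topologicalType)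
    (c d : chart R m M) : Prop :=
  smooth_on (chart_map c @` (chart_dom c `&` chart_dom d))
    (chart_map d \o chart_inv c).

Record smooth_manifold (R : realType) (m : nat) (M : topologicalType) :=
  SmoothManifold {
    atlas : set (chart R m M) ;
    manifold_hausdorff : hausdorff_space M ;
    manifold_second_countable : @second_countable M ;
    atlas_cover : forall x, exists2 c, atlas c & chart_dom c x ;
    atlas_compatible : forall c d, atlas c -> atlas d -> smooth_compatible c d }.

Definition chart_at (R : realType) (m : nat) (M : topologicalType)
    (S : smooth_manifold R m M) (x : M) : set (chart R m M) :=
  [set c | atlas S c /\ chart_dom c x].

Definition smooth_lagrangian (R : realType) (m : nat) (M : topologicalType)
    (S : smooth_manifold R m M) (L : M -> M -> R^o) : Prop :=
  forall c d, atlas S c -> atlas S d ->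
    smooth_on (chart_im c `*` chart_im d)
      (fun u : 'rV[R]_m * 'rV[R]_m => L (chart_inv c u.1) (chart_inv d u.2)).

Section DiscreteLagrangian.
Context (R : realType) (m : nat) (M : topologicalType).
Implicit Types (S : smooth_manifold R m M) (L : M -> M -> R^o)
  (c d : chart R m M).

(* Coordinates, in a chart around [x] (resp. [y]), of the covector
   d_1 L(x, y) in T*_x M (resp. d_2 L(x, y) in T*_y M). *)
Definition partial1 L c (x y : M) : 'rV[R]_m :=
  \row_i ('D_(delta_mx 0 i) (fun u => L (chart_inv c u) y) (chart_map c x)).

Definition partial2 L c (x y : M) : 'rV[R]_m :=
  \row_j ('D_(delta_mx 0 j) (fun u => L x (chart_inv c u)) (chart_map c y)).

(* An equation in T*_y M, hence independent of the chart around [y]. *)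
Definition discrete_EL S L (x y z : M) : Prop :=
  forall c, chart_at S y c -> partial2 L c x y + partial1 L c y z = 0.

(* Matrix of B(x, y) = - d_1 d_2 L(x, y) : T_x M -> T*_y M in the charts [c]
   around [x] and [d] around [y], with entry - d^2 L / (dy_j dx_i) in row j and
   column i. *)
Definition twist_mx L c d (x y : M) : 'M[R]_m :=
  \matrix_(j, i)
    - 'D_(delta_mx 0 j)
        (fun v => 'D_(delta_mx 0 i)
           (fun u => L (chart_inv c u) (chart_inv d v)) (chart_map c x))
        (chart_map d y).

Definition twist_nondegenerate S L (x y : M) : Prop :=
  forall c d, chart_at S x c -> chart_at S y d -> twist_mx L c d x y \in unitmx.

Definition periodic_trajectory S L (n : nat) (x : int -> M) : Prop :=
  (forall i, x (i + n%:Z) = x i) /\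
  (forall i, discrete_EL S L (x (i - 1)) (x i) (x (i + 1))).

(* [T i] is the branch, near [(x i, x (i + 1))], of the locally defined map
   T(x, y) = (y, z); its value away from that point is irrelevant.  The equation
   determines z only locally, and continuity selects the branch through
   [x (i + 2)]. *)
Definition lagrangian_map S L (x : int -> M) (T : int -> M * M -> M * M) : Prop :=
  forall i : int,
    [/\ T i (x i, x (i + 1)) = (x (i + 1), x (i + 2)),
        {for (x i, x (i + 1)), continuous (T i)} &
        \forall p \near (x i, x (i + 1)),
          (T i p).1 = p.2 /\ discrete_EL S L p.1 p.2 (T i p).2].

(* The composite T_n \o ... \o T_1 of the branches starting at (x_1, x_2). *)
Fixpoint lagrangian_iter (T : int -> M * M -> M * M) (n : nat) (p : M * M) :
    M * M :=
  if n is k.+1 then T k.+1%:Z (lagrangian_iter T k p) else p.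

(* Charts must be periodic too: T^n has to be read in the same charts at its
   source and at its target. *)
Definition periodic_charts S (n : nat) (x : int -> M) (c : int -> chart R m M) :
    Prop :=
  (forall i, chart_at S (x i) (c i)) /\ (forall i, c (i + n%:Z) = c i).

(* The point (x_1, ..., x_n) of M^n has as coordinates the n x m matrix whose
   row i : 'I_n (numbered from 0) contains the coordinates of x_(i + 1) in the
   chart c_(i + 1), flattened to a vector of length n * m. *)
Definition coords (n : nat) (c : int -> chart R m M) (x : int -> M) :
    'rV[R]_(n * m) :=
  mxvec (\matrix_(i < n) chart_map (c i.+1%:Z) (x i.+1%:Z)).

(* [ordS] is the cyclic successor, as x_(n + 1) = x_1. *)
Definition action L (n : nat) (c : int -> chart R m M) (u : 'rV[R]_(n * m)) :
    R^o :=
  let y (i : 'I_n) := chart_inv (c i.+1%:Z) (row i (vec_mx u)) in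
  \sum_(i < n) L (y i) (y (ordS i)).

Definition hessian (N : nat) (f : 'rV[R]_N -> R^o) (u : 'rV[R]_N) : 'M[R]_N :=
  \matrix_(a, b) 'D_(delta_mx 0 a) ('D_(delta_mx 0 b) f) u.

Definition action_hessian L (n : nat) (c : int -> chart R m M) (x : int -> M) :
    'M[R]_(n * m) :=
  hessian (action L c) (coords n c x).

(* [rootsR] lists each real root once, so multiplicities come from [mup]. *)
Definition morse_index (N : nat) (H : 'M[R]_N) : nat :=
  (\sum_(r <- rootsR (char_poly H) | (r < 0)%R) mup r (char_poly H))%N.

Definition twist_sign L (n : nat) (c : int -> chart R m M) (x : int -> M) : R :=
  Num.sg (\prod_(i < n)
    \det (twist_mx L (c i.+1%:Z) (c i.+2%:Z) (x i.+1%:Z) (x i.+2%:Z))).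

Definition return_map (n : nat) (c : int -> chart R m M)
    (T : int -> M * M -> M * M) (u : 'rV[R]_m * 'rV[R]_m) :
    'rV[R]_m * 'rV[R]_m :=
  let q := lagrangian_iter T n (chart_inv (c 1) u.1, chart_inv (c 2) u.2) in
  (chart_map (c 1) q.1, chart_map (c 2) q.2).

Definition real_multiplier (n : nat) (c : int -> chart R m M) (x : int -> M)
    (T : int -> M * M -> M * M) (rho : R) : Prop :=
  let u := (chart_map (c 1) (x 1), chart_map (c 2) (x 2)) in
  differentiable (return_map n c T) u /\
  exists2 v : 'rV[R]_m * 'rV[R]_m,
    v != 0 & 'd (return_map n c T) u v = rho *: v.

End DiscreteLagrangian.

(* Main.v *)
Require Import Defs.
From HB Require Import structures.
From mathcomp Require Import all_boot all_order all_algebra.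
From mathcomp Require Import fingroup perm.
From mathcomp Require Import polyrcf.
From mathcomp Require Import all_classical all_reals all_analysis.
From mathcomp Require Import ring lra zify.
Import Order.TTheory GRing.Theory Num.Theory.
Import numFieldNormedType.Exports.
Local Open Scope classical_set_scope.
Local Open Scope ring_scope.

(** Fix periodic charts, let l_k(u, v) be the Lagrangian read in the charts
around x_(k+1) and x_(k+2), and let a_k, b_k, d_k be the blocks
d_1 d_1 l_k, d_1 d_2 l_k, d_2 d_2 l_k of its Hessian at the trajectory; the
matrix of B(x_(k+1), x_(k+2)) is - b_k^T.  With A_k = a_k + d_(k-1), the Hessian
of the action is cyclic block tridiagonal, H = C^T + A + C, where A is block
diagonal and C carries the blocks b_k at the positions (k, k+1), the indices
being taken modulo n ([action_hessian_blocks]).  This block form uses the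
symmetry of second derivatives, [derive2_sym].

Consider the deformation M(t) = C^T + t A + t^2 C.  Its determinant is a
polynomial in t with det M(1) = det H and det M(0) = det C, and
  - det H has the sign (-1)^(ind H).  No diagonalisation is needed: this is the
    behaviour at -oo and at 0 of the characteristic polynomial
    ([sgr_det_morse]);
  - det C = (-1)^m prod_k det (- b_k), since C is the product of a block
    diagonal matrix by a cyclic shift of n blocks of size m
    ([det_cyclic_block]).
The sign condition says exactly that these two determinants have opposite
signs, so that det M(t) = 0 for some 0 < t < 1.  If the block row X is a
left null vector of M(t), then xi_k = t^(-k) X_(k mod n) satisfies
  xi_k b_k + xi_(k+1) A_(k+1) + xi_(k+2) b_(k+1)^T = 0
and xi_(k+n) = t^(-n) xi_k ([cyclic_multiplier]).

The displayed recursion is the linearised discrete Euler-Lagrange equation.  As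
the blocks b_k are invertible, each continuous branch of the Lagrangian map is
differentiable at the trajectory and its differential sends
(xi_k, xi_(k+1)) to (xi_(k+1), xi_(k+2)) ([implicit_diff], [local_map_diff]).
By the chain rule the differential of T^n sends (xi_0, xi_1) to
(xi_n, xi_(n+1)) = t^(-n) (xi_0, xi_1), which is nonzero because the recursion
determines xi from (xi_0, xi_1).  Hence t^(-n) > 1 is a real multiplier. *)

Set Implicit Arguments.
Unset Strict Implicit.

(** * The sign of a determinant and the Morse index *)

Lemma factor_roots (R : fieldType) (p : {poly R}) (s : seq R) :
  p != 0 -> uniq s ->
  exists2 g : {poly R}, p = g * \prod_(a <- s) ('X - a%:P) ^+ mup a p
    & forall a, a \in s -> ~~ root g a.
Proof.
move=> p0; elim: s => [|a s IH] /=; first by exists p; rewrite ?big_nil ?mulr1.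
case/andP=> as_ /IH[g pE gs].
have g0 : g != 0 by apply: contra_neq p0 => g0; rewrite pE g0 mul0r.
have [k [q]] := @multiplicity_XsubC R g a; rewrite g0 /= => qa gE.
have prod_a : ~~ root (\prod_(b <- s) ('X - b%:P) ^+ mup b p) a.
  elim: (s) as_ => [|b t IHt]; first by rewrite big_nil root1.
  rewrite inE negb_or big_cons rootM negb_or => /andP[ab /IHt ->].
  by case: (mup b p) => [|j]; rewrite ?expr0 ?root1 // root_exp_XsubC ab.
have mupE : mup a p = k.
  by rewrite {1}pE mupMl // gE mupMr // mup_XsubCX eqxx.
exists q => [|b]; first by rewrite big_cons mupE mulrA -gE.
rewrite inE => /predU1P[-> //|/gs]; apply: contra => qb.
by rewrite gE rootM qb.
Qed.

(** Dividing [p] by its negative linear factors, which are positive at 0, leaves a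
polynomial without roots on the negative half-line, whose sign at 0 is
therefore its sign at -oo, given by its degree. *)
Lemma monic_sgr_horner0 (R : rcfType) (p : {poly R}) :
  p \is monic -> ~~ root p 0 ->
  Num.sg p.[0] =
    (-1) ^+ ((size p).-1 + (\sum_(r <- rootsR p | (r < 0)%R) mup r p))%N.
Proof.
move=> pm p00; have p0 := monic_neq0 pm.
pose s := [seq r <- rootsR p | r < 0].
have us : uniq s.
  apply: filter_uniq.
  exact: sorted_uniq lt_trans (@ltxx _ _) _ (sorted_roots _ _ _).
have [g pE gs] := factor_roots p0 us.
set h := \prod_(a <- s) _ in pE.
have hm : h \is monic by apply: monic_prod => a _; rewrite monic_exp ?monicXsubC.
have gm : g \is monic by rewrite -(monicMr _ hm) -pE.
have sh : size h = (\sum_(r <- rootsR p | (r < 0)%R) mup r p).+1.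
  rewrite -big_filter -/s /h; elim: (s) => [|a t IHt].
    by rewrite !big_nil size_poly1.
  rewrite !big_cons size_monicM ?monic_exp ?monicXsubC //; last first.
    by rewrite monic_neq0 // monic_prod // => b _; rewrite monic_exp ?monicXsubC.
  by rewrite IHt size_exp_XsubC addSn /= addnS.
have h0 : Num.sg h.[0] = 1.
  apply: gtr0_sg; rewrite horner_prod /s big_filter.
  apply: prodr_gt0 => r r0.
  by rewrite horner_exp hornerXsubC sub0r exprn_gt0 // oppr_gt0.
have g_no : {in `]-oo, 0], forall x, ~~ root g x}.
  move=> x; rewrite in_itv /= le_eqVlt => /predU1P[->|x0].
    by apply: contra p00 => g00; rewrite pE rootM g00.
  apply/negP => gx.
  have: x \in s.
    rewrite mem_filter x0 /=; apply: (root_roots_on (roots_on_rootsR p0)) => //.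
    by rewrite pE rootM gx.
  by move/gs; rewrite gx.
have -> : Num.sg p.[0] = sgp_minfty g.
  rewrite pE hornerM sgrM h0 mulr1; apply: (sgp_minftyP g_no).
  by rewrite in_itv /= lexx.
rewrite /sgp_minfty (monicP gm) mulr1 sgrX sgrN1.
have := congr1 (fun q : {poly R} => size q) pE.
rewrite /= size_monicM ?monic_neq0 // sh addnS /= => ->.
have := monic_neq0 gm; rewrite -size_poly_gt0; case: (size g) => [|k] //= _.
rewrite -addnA addnn exprD -[X in _ = _ * X]signr_odd odd_double mulr1 ?expr0 ?mulr1 //.
Qed.

(** The symmetry of [H] is not needed: pairs of conjugate complex eigenvalues
contribute a positive factor to the determinant. *)
Lemma sgr_det_morse (R : realType) (N : nat) (H : 'M[R]_N) :
  \det H != 0 -> Num.sg (\det H) = (-1) ^+ morse_index H.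
Proof.
move=> H0; have detE : (char_poly H).[0] = (-1) ^+ N * \det H.
  by rewrite horner_coef0 char_poly_det.
have := @monic_sgr_horner0 R (char_poly H) (char_poly_monic H).
rewrite rootE detE mulf_eq0 signr_eq0 (negPf H0) => /(_ isT).
rewrite size_char_poly /= sgrM sgrX sgrN1 exprD.
exact: (can_inj (signrMK N)).
Qed.

(** * Determinants of cyclic block matrices *)

(** The determinant of a matrix with entries [F] over a finite index type does not
depend on the numbering of that type. *)
Lemma det_reindex (R : comPzRingType) (I : finType) (N N' : nat)
    (g : 'I_N -> I) (g' : 'I_N' -> I) (F : I -> I -> R) :
  bijective g -> bijective g' ->
  \det (\matrix_(k, l) F (g k) (g l)) = \det (\matrix_(k, l) F (g' k) (g' l)).
Proof.
move=> gb [h' g'K h'K].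
have NN' : N = N'.
  have := bij_eq_card gb; rewrite card_ord => ->.
  by rewrite -(bij_eq_card (Bijective g'K h'K)) card_ord.
subst N'.
have hinj : injective (h' \o g).
  by apply: inj_comp; [exact: can_inj h'K | exact: bij_inj gb].
set A := \matrix_(k, l) F (g' k) (g' l); pose s := perm hinj.
have -> : \matrix_(k, l) F (g k) (g l) = row_perm s (col_perm s A).
  by apply/matrixP => k l; rewrite !mxE !permE /= !h'K.
rewrite row_permE col_permE !det_mulmx !det_perm odd_permV.
by rewrite [\det A * _]mulrC mulrA -signr_addb addbb mul1r.
Qed.

(** The inverse of [mxvec_index]: the block number and the position in the block
of an index of a matrix with [n] blocks of size [m]. *)
Definition mxvec_pair (n m : nat) (k : 'I_(n * m)) : 'I_n * 'I_m :=
  let: isMxvecIndex i j := mxvec_indexP k in (i, j).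

Lemma mxvec_pairK (n m : nat) :
  cancel (@mxvec_pair n m) (fun u => mxvec_index u.1 u.2).
Proof. by move=> k; rewrite /mxvec_pair; case: mxvec_indexP. Qed.

Lemma mxvec_indexK (n m : nat) :
  cancel (fun u => mxvec_index u.1 u.2) (@mxvec_pair n m).
Proof.
move=> u; have inj : injective (fun u : 'I_n * 'I_m => mxvec_index u.1 u.2).
  move=> [i j] [i' j'] /cast_ord_inj /enum_rank_inj; exact.
by apply: inj; rewrite mxvec_pairK.
Qed.

Lemma mxvec_pair_bij (n m : nat) : bijective (@mxvec_pair n m).
Proof.
exists (fun u => mxvec_index u.1 u.2); [exact: mxvec_pairK | exact: mxvec_indexK].
Qed.

(** The numbering [g] of the pairs (block, position in the block) is arbitrary, so
that the lemma applies both to [n] blocks of size [m] and, after exchanging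
the two components, to [m] blocks of size [n]. *)
Lemma det_block_diag (R : comPzRingType) (n m N : nat)
    (g : 'I_N -> 'I_n * 'I_m) (B : 'I_n -> 'M[R]_m) :
  bijective g ->
  \det (\matrix_(k, l)
          (B (g k).1 (g k).2 (g l).2 *+ ((g k).1 == (g l).1))) =
  \prod_i \det (B i).
Proof.
pose F p (B : 'I_p -> 'M[R]_m) (u v : 'I_p * 'I_m) :=
  B u.1 u.2 v.2 *+ (u.1 == v.1).
rewrite -[\matrix_(k, l) _]/(\matrix_(k, l) F n B (g k) (g l)).
elim: n N g B => [|n IHn] N g B gb.
  have N0 : N = 0%N by have := bij_eq_card gb; rewrite card_prod !card_ord.
  by move: g gb; rewrite N0 => g _; rewrite det_mx00 big_ord0.
pose vi (u : 'I_n * 'I_m) := mxvec_index u.1 u.2.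
pose g1 := @mxvec_pair n m.
have g1K : cancel g1 vi := @mxvec_pairK n m.
have viK : cancel vi g1 := @mxvec_indexK n m.
pose h (k : 'I_(m + n * m)) : 'I_n.+1 * 'I_m :=
  match fintype.split k with
  | inl a => (ord0, a) | inr k => (lift ord0 (g1 k).1, (g1 k).2) end.
have hb : bijective h.
  exists (fun u => if unlift ord0 u.1 is Some i then rshift m (vi (i, u.2))
                   else lshift (n * m) u.2).
    move=> k; rewrite /h; case: splitP => j kj /=.
      by rewrite unlift_none; apply: val_inj.
    rewrite liftK; apply: val_inj; rewrite [RHS]kj [LHS]/=.
    by congr addn; exact: (congr1 val (g1K j)).
  move=> [i a] /=; case: unliftP => [j ->|->]; rewrite /h.
    rewrite (unsplitK (inr _)) [vi]lock /= -lock.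
    by rewrite viK.
  by rewrite (unsplitK (inl _)).
rewrite (det_reindex (F n.+1 B) gb hb) big_ord_recl.
have -> : \matrix_(k, l) F n.+1 B (h k) (h l) =
  block_mx (B ord0) 0 0 (\matrix_(k, l) F n (fun i => B (lift ord0 i)) (g1 k) (g1 l)).
  rewrite -[LHS]submxK; congr block_mx; apply/matrixP => k l; rewrite !mxE /F /h;
    rewrite ?(unsplitK (inr _)) ?(unsplitK (inl _)) /= ?eqxx ?mulr1n //.
by rewrite det_ublock IHn //; exact: mxvec_pair_bij.
Qed.

(** The cyclic shift is a single [n]-cycle. *)
Lemma det_perm_ordS (R : comPzRingType) (n : nat) : (0 < n)%N ->
  \det (perm_mx (perm (@ordS_inj n)) : 'M[R]_n) = (-1) ^+ n.-1.
Proof.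
move=> n0; rewrite det_perm /odd_perm card_ord.
set s := perm _.
have sE (i : 'I_n) k : (s ^+ k)%g i = ((i + k) %% n)%N :> nat.
  elim: k => [|k IHk]; first by rewrite perm1 addn0 modn_small.
  by rewrite expgSr permM permE /= IHk -addn1 modnDml addn1 addnS.
have s_trans (i j : 'I_n) : j \in porbit s i.
  apply/porbitP; exists (j + (n - i))%N; apply: val_inj.
  rewrite [RHS]sE addnCA subnKC ?(ltnW (ltn_ord i)) //.
  by rewrite modnDr modn_small.
have -> : porbits s = [set [set: 'I_n]%SET]%SET.
  apply/setP => A; rewrite inE; apply/imsetP/eqP => [[i _ ->]|->].
    by apply/setP => j; rewrite inE s_trans.
  by exists (Ordinal n0) => //; apply/esym/setP => j; rewrite inE s_trans.
rewrite cards1 -[RHS]signr_odd; case: n n0 {s sE s_trans} => //= k _.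
by rewrite addbT negbK.
Qed.

Lemma sum_mxvec_index (R : nmodType) (n m : nat) (F : 'I_(n * m) -> R) :
  \sum_k F k = \sum_(i < n) \sum_(j < m) F (mxvec_index i j).
Proof.
rewrite pair_big /= (reindex (fun u : 'I_n * 'I_m => mxvec_index u.1 u.2)) //=.
by exists (@mxvec_pair n m) => u _; [exact: mxvec_indexK | exact: mxvec_pairK].
Qed.

(** [C] is a block diagonal matrix [D] times the shift [S] of blocks.  Grouping the
indices by their position in the block, [S] is block diagonal too, with [m]
copies of the cyclic permutation matrix. *)
Lemma det_cyclic_block (R : comPzRingType) (n m : nat) (b : 'I_n -> 'M[R]_m)
    (C : 'M[R]_(n * m)) :
  (0 < n)%N ->
  (forall k i l j, C (mxvec_index k i) (mxvec_index l j) =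
     b k i j *+ (l == ordS k)) ->
  \det C = (-1) ^+ m * \prod_k \det (- b k).
Proof.
move=> n0 CE.
pose g := @mxvec_pair n m; pose g' (k : 'I_(n * m)) := ((g k).2, (g k).1).
have gE (k : 'I_n) (i : 'I_m) : g (mxvec_index k i) = (k, i).
  exact: (mxvec_indexK (k, i)).
pose D : 'M[R]_(n * m) :=
  \matrix_(k, l) (b (g k).1 (g k).2 (g l).2 *+ ((g k).1 == (g l).1)).
pose s : 'M[R]_n := perm_mx (perm (@ordS_inj n)).
pose S : 'M[R]_(n * m) :=
  \matrix_(k, l) (s (g' k).2 (g' l).2 *+ ((g' k).1 == (g' l).1)).
have -> : C = D *m S.
  apply/matrixP => p q; rewrite -(mxvec_pairK p) -(mxvec_pairK q).
  case: (mxvec_pair p) (mxvec_pair q) => [k i] [l j] /=.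
  rewrite CE mxE sum_mxvec_index (bigD1 k) //= [X in _ = _ + X]big1 ?addr0; last first.
    move=> k' /negPf k'k; rewrite big1 // => j' _.
    by rewrite !mxE !gE /= eq_sym k'k mulr0n mul0r.
  rewrite (bigD1 j) //= [X in _ = _ + X]big1 ?addr0; last first.
    by move=> j' /negPf j'j; rewrite !mxE /g' !gE /= j'j mulr0n mulr0.
  rewrite !mxE /g' !gE /= !eqxx permE eq_sym.
  by case: eqP; rewrite ?mulr1n ?mulr0n ?mulr1 ?mulr0.
rewrite det_mulmx (det_block_diag _ (mxvec_pair_bij n m)).
have g'b : bijective g'.
  exists (fun u => mxvec_index u.2 u.1) => [k|[i k]]; first exact: mxvec_pairK.
  by rewrite /g' gE.
rewrite (det_block_diag (fun=> s) g'b) prodr_const card_ord det_perm_ordS //.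
under [in RHS]eq_bigr do rewrite -scaleN1r detZ.
rewrite big_split /= prodr_const card_ord [RHS]mulrA mulrC; congr (_ * _).
(* (n - 1) m and m + m n have the same parity. *)
rewrite -!exprM -exprD -[LHS]signr_odd (_ : odd _ = odd (m + m * n)) ?signr_odd //.
rewrite oddD !oddM; case: n n0 {b C CE g g' gE D s S g'b} => //= k _.
by case: odd; case: odd.
Qed.

Lemma periodic_modn (T : Type) (n : nat) (F : nat -> T) :
  (forall k, F (k + n)%N = F k) -> forall k, F (k %% n)%N = F k.
Proof.
move=> Fn k; rewrite {2}(divn_eq k n) addnC.
by elim: (k %/ n)%N => [|d IHd]; rewrite ?addn0 // mulSn addnCA addnC Fn.
Qed.

(** The linear algebra of the problem: if the determinant of a cyclic block
tridiagonal matrix and that of its upper corner part have opposite signs, the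
second order recursion that it encodes has a quasi-periodic solution with a
factor larger than 1. *)
Lemma cyclic_multiplier (R : rcfType) (n m : nat) (A b : nat -> 'M[R]_m)
    (H : 'M[R]_(n * m)) :
  (0 < n)%N ->
  (forall k, A (k + n)%N = A k) -> (forall k, b (k + n)%N = b k) ->
  (forall (k : 'I_n) i (l : 'I_n) j, H (mxvec_index k i) (mxvec_index l j) =
     A k i j *+ (l == k) + b k i j *+ (l == ordS k) + b l j i *+ (k == ordS l)) ->
  \det H * ((-1) ^+ m * \prod_(k < n) \det (- b k)) < 0 ->
  exists rho : R, exists2 xi : nat -> 'rV[R]_m, 1 < rho &
    [/\ exists k, xi k != 0, forall k, xi (k + n)%N = rho *: xi k &
     forall k, xi k *m b k + xi k.+1 *m A k.+1 + xi k.+2 *m (b k.+1)^T = 0].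
Proof.
move=> n0 An bn HE sgn.
pose g := @mxvec_pair n m.
have gE (k : 'I_n) (i : 'I_m) : g (mxvec_index k i) = (k, i).
  exact: (mxvec_indexK (k, i)).
pose C : 'M[R]_(n * m) :=
  \matrix_(p, q) (b (g p).1 (g p).2 (g q).2 *+ ((g q).1 == ordS (g p).1)).
pose DA : 'M[R]_(n * m) :=
  \matrix_(p, q) (A (g p).1 (g p).2 (g q).2 *+ ((g q).1 == (g p).1)).
have detC : \det C = (-1) ^+ m * \prod_(k < n) \det (- b k).
  apply: (det_cyclic_block (b := fun k : 'I_n => b k)) => // k i l j.
  by rewrite mxE !gE.
have HE' : H = C^T + DA + C.
  apply/matrixP => p q; rewrite -(mxvec_pairK p) -(mxvec_pairK q).
  case: (mxvec_pair p) (mxvec_pair q) => [k i] [l j] /=.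
  by rewrite HE !mxE !gE /= -[RHS]addrA [RHS]addrC.
pose M (t : R) := C^T + t *: DA + t ^+ 2 *: C.
pose P : 'M[{poly R}]_(n * m) :=
  map_mx polyC C^T + 'X *: map_mx polyC DA + 'X^2 *: map_mx polyC C.
have PE t : (\det P).[t] = \det (M t).
  rewrite -horner_evalE -det_map_mx; congr (\det _); apply/matrixP => p q.
  by rewrite !mxE /= /horner_eval !(hornerD, hornerM, hornerX, hornerXn, hornerC).
(* M(0) = C^T and M(1) = H have determinants of opposite signs. *)
have [] := @poly_ivtoo R (\det P) 0 1 ler01.
  rewrite !PE /M expr1n !scale1r -HE' expr0n !scale0r !addr0 det_tr detC.
  by rewrite mulrC.
move=> t; rewrite in_itv /= => /andP[t0 t1]; rewrite rootE PE => /det0P[v v0 vM].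
pose X (k : nat) : 'rV[R]_m := row (Ordinal (ltn_pmod k n0)) (vec_mx v).
have XE (k : 'I_n) i : v 0 (mxvec_index k i) = X k 0 i.
  rewrite !mxE; congr (v _ (mxvec_index _ _)).
  by apply: val_inj; rewrite /= modn_small.
have Xn k : X (k + n)%N = X k.
  by congr (row _ _); apply: val_inj; rewrite /= modnDr.
clearbody X.
have eqX (l : 'I_n) :
    X (ordS l) *m (b l)^T + t *: (X l *m A l) +
      t ^+ 2 *: (X (ord_pred l) *m b (ord_pred l)) = 0.
  apply/rowP => j.
  have := congr1 (fun u : 'rV_(n * m) => u 0 (mxvec_index l j)) vM.
  rewrite /M !mulmxDr -!scalemxAr !mxE => vM0.
  rewrite -[RHS]vM0; congr (_ + _ * _ + _ * _).
  - rewrite sum_mxvec_index (bigD1 (ordS l)) //= [X in _ = _ + X]big1 ?addr0.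
      by apply: eq_bigr => i _; rewrite !mxE !gE /= eqxx mulr1n XE.
    move=> k /negPf kl; rewrite big1 // => i _.
    by rewrite !mxE !gE /= kl mulr0n mulr0.
  - rewrite sum_mxvec_index (bigD1 l) //= [X in _ = _ + X]big1 ?addr0.
      by apply: eq_bigr => i _; rewrite !mxE !gE /= eqxx mulr1n XE.
    move=> k /negPf kl; rewrite big1 // => i _.
    by rewrite !mxE !gE /= eq_sym kl mulr0n mulr0.
  - rewrite sum_mxvec_index (bigD1 (ord_pred l)) //= [X in _ = _ + X]big1 ?addr0.
      by apply: eq_bigr => i _; rewrite !mxE !gE /= ord_predK eqxx mulr1n XE.
    move=> k kl; rewrite big1 // => i _.
    rewrite !mxE !gE /= [l == _](_ : _ = false) ?mulr0n ?mulr0 //.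
    by apply: contra_neqF kl => /eqP ->; rewrite ordSK.
have tN0 : t != 0 by rewrite gt_eqF.
exists (t ^- n), (fun k => t ^- k *: X k).
  by rewrite invf_gt1 ?exprn_gt0 // exprn_ilt1 // -?lt0n ?ltW.
split.
- have [p vp] : exists p, v 0 p != 0.
    apply/existsP; apply: contraNT v0 => /existsPn v00; apply/eqP/rowP => p.
    by rewrite mxE; apply/eqP; have := v00 p; rewrite negbK.
  case/mxvec_indexP: p vp => k i; rewrite XE => Xk; exists k.
  rewrite scaler_eq0 negb_or invr_eq0 expf_neq0 //=.
  by apply: contra_neq Xk => ->; rewrite mxE.
- by move=> k; rewrite Xn scalerA exprD invfM mulrC.
move=> k; pose l : 'I_n := Ordinal (ltn_pmod k.+1 n0).
have := eqX l.
have -> : ord_pred l = Ordinal (ltn_pmod k n0).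
  apply: (can_inj (@ordSK n)); rewrite ord_predK; apply: val_inj => /=.
  by rewrite -addn1 -[in RHS]addn1 modnDml.
have -> : X (ordS l) = X k.+2.
  rewrite -(periodic_modn Xn k.+2); congr X => /=.
  by rewrite -addn1 modnDml addn1.
rewrite /= !(periodic_modn Xn) !(periodic_modn An) !(periodic_modn bn) => E.
rewrite -!scalemxAl -[RHS](scaler0 _ (t ^- k.+2)) -E !scalerDr !scalerA.
have e1 : t ^- k.+1 = t ^- k.+2 * t by rewrite -[k.+2]addn1 exprD invfM expr1 divfK.
have e2 : t ^- k = t ^- k.+2 * t ^+ 2 by rewrite -[k.+2]addn2 exprD invfM divfK ?expf_neq0.
by rewrite -e1 -e2 [LHS]addrC [LHS]addrA [LHS]addrAC.
Qed.

(** * Symmetry of second derivatives *)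

Lemma is_derive_line (R : realType) (V : normedModType R) (f : V -> R^o)
    (q a : V) (s : R) :
  derivable f (q + s *: a) a ->
  is_derive s (1 : R) (fun t : R => f (q + t *: a) : R) ('D_a f (q + s *: a)).
Proof.
move=> df.
have E : (fun h : R => h^-1 *: (((fun t : R => f (q + t *: a) : R^o) \o shift s) (h *: (1 : R))
            - f (q + s *: a))) =
         (fun h : R => h^-1 *: ((f \o shift (q + s *: a)) (h *: a) - f (q + s *: a))).
  apply/funext => h /=; congr (_ *: (f _ - _)).
  by rewrite [h *: 1]mulr1 scalerDl addrCA.
by split; rewrite /derivable /derive E.
Qed.

Lemma near_parallelogram (R : realType) (V : normedModType R) (K : set V) (p a b : V) :
  nbhs p K ->
  exists2 d : R, 0 < d &
    forall s t, 0 <= s < d -> 0 <= t < d -> K (p + s *: a + t *: b).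
Proof.
move=> nK.
have lin : (fun st : R * R => p + st.1 *: a + st.2 *: b) @ ((0 : R), (0 : R)) --> p.
  rewrite -[X in _ --> X]addr0 -[X in _ --> X + _]addr0.
  rewrite -[X in _ + X + _](scale0r a) -[X in _ + _ + X](scale0r b).
  apply: cvgD; first apply: cvgD; first exact: cvg_cst.
    by apply: cvgZr_tmp; exact: cvg_fst.
  by apply: cvgZr_tmp; exact: cvg_snd.
have /nbhs_ballP[d /= d0 dK] := lin _ nK.
exists d => // s t /andP[s0 sd] /andP[t0 td]; apply: (dK (s, t)); split => /=.
  by rewrite /ball /= sub0r normrN ger0_norm.
by rewrite /ball /= sub0r normrN ger0_norm.
Qed.

(** Two applications of the mean value theorem turn the second difference into
h^2 times a value of the mixed derivative near [p]. *)
Lemma second_difference (R : realType) (V : normedModType R) (f : V -> R^o)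
    (U : set V) (p a b : V) (e : R) :
  open U -> U p -> is_Ck 2 U f -> 0 < e ->
  \forall h \near 0^'+,
    `|f (p + h *: b + h *: a) - f (p + h *: a) - (f (p + h *: b) - f p)
       - h ^+ 2 * 'D_b ('D_a f) p| <= e * h ^+ 2.
Proof.
move=> Uo Up [df d2] e0.
have /= [dDf _] := d2 a; have /= /(_ b) cD := (d2 a).2.
pose K q := U q /\ `|'D_b ('D_a f) p - 'D_b ('D_a f) q| <= e.
have nK : \forall q \near p, K q.
  near=> q; split; first by near: q; apply: open_nbhs_nbhs.
  near: q; have := cD p Up => /cvgrPdist_le; exact.
have [d d0 dK] := near_parallelogram a b nK.
near=> h.
have h0 : 0 < h by near: h; exact: nbhs_right_gt.
have hd : h < d by near: h; exact: nbhs_right_lt.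
pose phi (s : R) : R := f (p + h *: b + s *: a) - f (p + s *: a).
have phiD (s : R) : 0 <= s <= h ->
    is_derive s (1 : R) phi ('D_a f (p + h *: b + s *: a) - 'D_a f (p + s *: a)).
  move=> /andP[s0 sh]; apply: is_deriveB; apply: is_derive_line.
    apply/diff_derivable/df; rewrite addrAC.
    by case: (dK s h) => //; rewrite ?s0 ?(ltW h0) //= (le_lt_trans sh).
  apply/diff_derivable/df; rewrite -[_ + _]addr0 -(scale0r b).
  by case: (dK s 0) => //; rewrite ?s0 ?lexx ?(le_lt_trans sh) //= (lt_trans h0).
have [||s] := @MVT R phi
  (fun s => 'D_a f (p + h *: b + s *: a) - 'D_a f (p + s *: a)) 0 h h0.
- by move=> s; rewrite in_itv /= => /andP[/ltW s0 /ltW sh]; apply: phiD; rewrite s0.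
- apply: derivable_within_continuous => s; rewrite in_itv /= => sh.
  by have [] := phiD s sh.
rewrite in_itv /= => /andP[s0 sh] phiE.
pose psi (t : R) : R := 'D_a f (p + s *: a + t *: b).
have psiD (t : R) : 0 <= t <= h ->
    is_derive t (1 : R) psi ('D_b ('D_a f) (p + s *: a + t *: b)).
  move=> /andP[t0 th]; apply: is_derive_line.
  apply/diff_derivable/dDf.
  by case: (dK s t) => //; rewrite ?t0 ?(ltW s0) ?(le_lt_trans th) //= (lt_trans sh).
have [||t] := @MVT R psi (fun t => 'D_b ('D_a f) (p + s *: a + t *: b)) 0 h h0.
- by move=> t; rewrite in_itv /= => /andP[/ltW t0 /ltW th]; apply: psiD; rewrite t0.
- apply: derivable_within_continuous => t; rewrite in_itv /= => th.
  by have [] := psiD t th.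
rewrite in_itv /= => /andP[t0 th] psiE.
have [_ Kst] : K (p + s *: a + t *: b).
  by apply: dK; rewrite ltW //= ?(lt_trans sh) ?(lt_trans th).
have -> : f (p + h *: b + h *: a) - f (p + h *: a) - (f (p + h *: b) - f p) =
  h ^+ 2 * 'D_b ('D_a f) (p + s *: a + t *: b).
  transitivity (phi h - phi 0); first by rewrite /phi !scale0r !addr0.
  rewrite phiE (addrAC p) subr0.
  move: psiE; rewrite /psi scale0r addr0 subr0 => ->.
  by rewrite -mulrA -expr2 mulrC.
move: Kst; move: ('D_b ('D_a f) _) ('D_b ('D_a f) p) => X Y; rewrite distrC => XY.
rewrite (_ : h ^+ 2 * X - h ^+ 2 * Y = h ^+ 2 * ((X : R) - (Y : R))); last by rewrite mulrBr.
by rewrite normrM normrX (ger0_norm (ltW h0)) mulrC ler_wpM2r ?sqr_ge0.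
Unshelve. all: by end_near. Qed.

(** Both estimates bear on the same second difference, the middle terms [y] and
[z] being exchanged. *)
Lemma dist_le_of_common_difference (R : realFieldType) (x y z w a b t e : R) :
  0 < t -> `|x - y - (z - w) - t * a| <= e / 2 * t ->
  `|x - z - (y - w) - t * b| <= e / 2 * t -> `|b - a| <= e.
Proof.
move=> t0; rewrite !ler_norml => /andP[A1 A2] /andP[B1 B2].
have P : t * (b - a) <= t * e by lra.
have N : t * - e <= t * (b - a) by lra.
by rewrite -(ler_pM2l t0) N -(ler_pM2l t0).
Qed.

(** Schwarz's theorem for directional derivatives of a C^2 function. *)
Lemma derive2_sym (R : realType) (V : normedModType R) (f : V -> R^o)
    (U : set V) (p a b : V) :
  open U -> U p -> is_Ck 2 U f -> 'D_a ('D_b f) p = 'D_b ('D_a f) p.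
Proof.
move=> Uo Up Cf; apply/eqP; rewrite -subr_eq0 -normr_le0; apply/ler_addgt0Pl => e e0.
rewrite addr0.
have e2 : 0 < e / 2 by rewrite divr_gt0.
have nA := @second_difference R V f U p a b (e / 2) Uo Up Cf e2.
have nB := @second_difference R V f U p b a (e / 2) Uo Up Cf e2.
have [h [[h0 A] B]] := filter_ex (filterI (filterI (nbhs_right_gt (0 : R)) nA) nB).
rewrite (addrAC p (h *: a)) in B.
have h2 : 0 < h ^+ 2 by rewrite exprn_gt0.
exact: (dist_le_of_common_difference h2 A B).
Qed.

(** * Differentiability of implicit functions *)

Lemma diff_remainder (R : realType) (V W : normedModType R) (f : V -> W) (a : V) (e : R) :
  differentiable f a -> 0 < e ->
  \forall h \near 0, `|f (h + a) - f a - 'd f a h| <= e * `|h|.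
Proof.
move=> /diff_locally /eqaddoP /(_ e) /[swap] e0 /(_ e0).
by apply: filterS => h; rewrite /= !fctE /= opprD addrA.
Qed.

Lemma diff_of_remainder (R : realType) (V W : normedModType R) (f : V -> W) (a : V)
    (D : {linear V -> W}) :
  continuous D ->
  (forall e, 0 < e ->
     \forall h \near 0, `|f (h + a) - f a - D h| <= e * `|h|) ->
  differentiable f a /\ 'd f a = D :> (V -> W).
Proof.
move=> cD fD.
have E : f \o shift a = cst (f a) + D +o_ 0 id.
  apply/eqaddoP => e /fD.
  by apply: filterS => h; rewrite /= !fctE /= opprD addrA.
have dE : 'd f a = D :> (V -> W) by apply: diff_unique.
by split => //; apply/diff_locallyP; rewrite dE; split.
Qed.

Lemma le_mx_coord (R : realType) (k m : nat) (A : 'M[R]_(k, m)) i j :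
  `|A i j| <= `|A|.
Proof.
rewrite [leRHS]/Num.Def.normr /= mx_normrE.
exact: (le_bigmax _ (fun ij : 'I_k * 'I_m => `|A ij.1 ij.2|) (i, j)).
Qed.

Lemma norm_mulmx_le (R : realType) (m n : nat) (z : 'rV[R]_m) (B : 'M[R]_(m, n)) :
  `|z *m B| <= m%:R * `|B| * `|z|.
Proof.
have B0 : 0 <= m%:R * `|B| * `|z| by rewrite !mulr_ge0.
rewrite [leLHS]/Num.Def.normr /= mx_normrE.
apply: bigmax_le => // -[i j] _; rewrite mxE (le_trans (ler_norm_sum _ _ _)) //=.
have -> : m%:R * `|B| * `|z| = \sum_(l < m) `|B| * `|z|.
  by rewrite sumr_const card_ord -mulrA mulr_natl.
by apply: ler_sum => l _; rewrite normrM mulrC ler_pM ?le_mx_coord.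
Qed.

(** The differentiability part of the implicit function theorem: existence and
continuity of the implicit function [w] are assumed, and differentiability of
[G] at the single point (a, w a) suffices. *)
Lemma implicit_diff (R : realType) (V : normedModType R) (m : nat)
    (G : V * 'rV[R]_m -> 'rV[R]_m) (w : V -> 'rV[R]_m) (a : V) (B : 'M[R]_m) :
  differentiable G (a, w a) -> {for a, continuous w} ->
  (\forall p \near a, G (p, w p) = 0) ->
  B \in unitmx -> (forall z, 'd G (a, w a) (0, z) = z *m B) ->
  differentiable w a /\
  forall h, 'd G (a, w a) (h, 'd w a h) = 0.
Proof.
move=> dG cw Gw Bu GB.
pose L := 'd G (a, w a).
have LD h (z : 'rV[R]_m) : L (h, z) = L (h, 0) + z *m B.
  by rewrite -GB -linearD; congr ('d _ _ _); congr pair; rewrite /= ?addr0 ?add0r.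
pose D h := - (L (h, 0) *m invmx B).
have D_lin : linear D.
  move=> k u v; rewrite /D (_ : (k *: u + v, 0) = k *: (u, 0) + (v, 0)).
    by rewrite linearP mulmxDl -scalemxAl opprD scalerN.
  by congr pair; rewrite /= scaler0 addr0.
pose D_linM := GRing.isLinear.Build _ _ _ _ _ D_lin.
pose DL : {linear V -> 'rV[R]_m} := HB.pack D D_linM.
have [c c0 Lc] := linear_lipschitz (diff_continuous dG).
pose k := m%:R * `|invmx B| + 1.
have k0 : 0 < k by rewrite ltr_wpDl ?mulr_ge0.
have Bk (z : 'rV[R]_m) : `|z *m invmx B| <= k * `|z|.
  by rewrite (le_trans (norm_mulmx_le _ _)) // ler_wpM2r // lerDl.
have Dc h : `|D h| <= k * c * `|h|.
  rewrite normrN (le_trans (Bk _)) // -mulrA ler_wpM2l ?(ltW k0) //.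
  rewrite (le_trans (Lc _)) // ler_wpM2l ?(ltW c0) //.
  by rewrite prod_normE /= normr0 ge_max lexx normr_ge0.
have cD : continuous DL.
  apply/linear_bounded_continuous/linear_boundedP; near=> r => h.
  rewrite (le_trans (Dc h)) // ler_wpM2r //; near: r.
have Dh0 h (z : 'rV[R]_m) : L (h, z) = (z - D h) *m B.
  by rewrite LD /D opprK mulmxDl mulmxKV // addrC.
have cw0 : (fun h => (h, w (h + a) - w a)) @ 0 --> (0 : V * 'rV[R]_m).
  have cwa : (fun h => w (h + a)) @ (0 : V) --> w a.
    have : (w \o shift a) @ (0 : V) --> (w \o shift a) 0.
      by move: cw; rewrite continuous_shift.
    by rewrite /= add0r.
  have cw1 : (fun h => w (h + a) - w a) @ (0 : V) --> (0 : 'rV[R]_m).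
    by rewrite -(subrr (w a)); exact: cvgB cwa (cvg_cst _).
  exact: (cvg_pair (@cvg_id _ (nbhs (0 : V))) cw1).
suff [dw dwE] : differentiable w a /\ 'd w a = DL :> (V -> 'rV[R]_m).
  by split => // h; rewrite dwE -/L Dh0 subrr mul0mx.
apply: diff_of_remainder => // e e0.
pose C := 2 * (k * c) + 2.
have kc : 0 < k * c by rewrite mulr_gt0.
have C0 : 0 < C by rewrite /C; lra.
(* The second bound gives k e1 <= 1/2, which absorbs the term in z of the remainder
   and yields |h| + |z| <= C |h|; the first one then gives the factor e. *)
pose e1 := Num.min (e / (k * C)) (1 / (2 * k)).
have e10 : 0 < e1 by rewrite lt_min !divr_gt0 ?mulr_gt0.
have rem := cw0 _ (diff_remainder dG e10).
near=> h.
set z := w (h + a) - w a.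
have Gh : G (h + a, w (h + a)) = 0.
  by near: h; move: Gw; rewrite (near_shift 0 a) subr0.
have : `|L (h, z)| <= e1 * `|(h, z)|.
  have : `|G ((h, z) + (a, w a)) - G (a, w a) - L (h, z)| <= e1 * `|(h, z)|.
    by rewrite /z; near: h; exact: rem.
  rewrite (_ : (h, z) + (a, w a) = (h + a, w (h + a))); last first.
    by congr pair; rewrite /= /z subrK.
  by rewrite Gh (nbhs_singleton Gw) subrr sub0r normrN.
rewrite prod_normE /= => Lh.
have zD : `|z - D h| <= k * e1 * Num.max `|h| `|z|.
  rewrite -mulrA; apply: le_trans (ler_wpM2l (ltW k0) Lh).
  by rewrite Dh0 -[X in `|X| <= _](mulmxK Bu).
change (`|z - D h| <= e * `|h|).
have e1k : e1 * (2 * k) <= 1.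
  by rewrite -ler_pdivlMr ?mulr_gt0 // /e1 ge_min lexx orbT.
have e1C : e1 * (k * C) <= e.
  by rewrite -ler_pdivlMr ?mulr_gt0 // /e1 ge_min lexx.
have hz : Num.max `|h| `|z| <= `|h| + `|z|.
  by rewrite ge_max lerDl lerDr !normr_ge0.
have zle : `|z| <= `|z - D h| + `|D h|.
  by rewrite -[X in `|X| <= _](subrK (D h)) ler_normD.
have zC : `|h| + `|z| <= C * `|h|.
  have := Dc h; have := normr_ge0 h; have := normr_ge0 z.
  have : k * e1 * Num.max `|h| `|z| <= 2^-1 * (`|h| + `|z|).
    by apply: ler_pM => //; rewrite ?mulr_ge0 ?le_max ?normr_ge0 ?(ltW k0) ?(ltW e10) //; lra.
  rewrite /C; lra.
apply: (le_trans zD); apply: le_trans (_ : k * e1 * (C * `|h|) <= _).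
  by rewrite ler_wpM2l ?mulr_ge0 ?(ltW k0) ?(ltW e10) // (le_trans hz).
rewrite mulrA ler_wpM2r // (_ : k * e1 * C = e1 * (k * C)) //; ring.
Unshelve. all: by end_near. Qed.

(** * Directional derivatives along linear maps and in coordinates *)

Lemma nonexpansive_linear_continuous (R : realType) (V W : normedModType R) (f : V -> W) :
  linear f -> (forall u, `|f u| <= `|u|) -> continuous f.
Proof.
move=> f_lin f_le; pose fM := GRing.isLinear.Build _ _ _ _ _ f_lin.
pose F : {linear V -> W} := HB.pack f fM.
suff: continuous (F : V -> W) by [].
apply/linear_bounded_continuous/linear_boundedP; near=> r => u.
by rewrite (le_trans (f_le u)) // ler_peMl //; near: r; exact: nbhs_pinfty_ge.
Unshelve. all: by end_near. Qed.

Lemma nonexpansive_linear_diff (R : realType) (V W : normedModType R) (f : V -> W) (a : V) :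
  linear f -> (forall u, `|f u| <= `|u|) ->
  differentiable f a /\ 'd f a = f :> (V -> W).
Proof.
move=> f_lin f_le; have cf := nonexpansive_linear_continuous f_lin f_le.
pose fM := GRing.isLinear.Build _ _ _ _ _ f_lin.
pose F : {linear V -> W} := HB.pack f fM.
have cF : continuous F by [].
by split; [exact: (@linear_differentiable _ _ _ F) | exact: (@diff_lin _ _ _ F)].
Qed.

Lemma near_eq_diff (R : realType) (V W : normedModType R) (f g : V -> W) (a : V) :
  (\forall u \near a, f u = g u) -> differentiable f a ->
  differentiable g a /\ 'd g a = 'd f a :> (V -> W).
Proof.
move=> fg df; apply: (diff_of_remainder (diff_continuous df)).
move=> e e0; have := diff_remainder df e0.
move: (fg); rewrite (near_shift 0 a) subr0 => fg0.
move: fg0; apply: filterS2 => h /= fgh.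
by rewrite -fgh -(nbhs_singleton fg).
Qed.

(** No regularity of [f] and no continuity of [pi] is needed: both sides are limits
of the same difference quotients. *)
Lemma derive_comp_linear (R : realType) (V W Z : normedModType R) (f : W -> Z)
    (pi : V -> W) (u v : V) :
  linear pi -> 'D_v (f \o pi) u = 'D_(pi v) f (pi u).
Proof.
move=> pi_lin; rewrite /derive; set F := (X in _ = lim (X @ _)).
set G := (X in lim (X @ _) = _); suff -> : G = F by [].
apply/funext => h; rewrite /F /G /=.
by rewrite pi_lin.
Qed.

Lemma derivable_comp_linear (R : realType) (V W Z : normedModType R) (f : W -> Z)
    (pi : V -> W) (u v : V) :
  linear pi -> derivable f (pi u) (pi v) -> derivable (f \o pi) u v.
Proof.
move=> pi_lin; rewrite /derivable; set F := (X in cvg (X @ _)) => cF.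
set G := (X in cvg (X @ _)); suff -> : G = F by [].
by apply/funext => h; rewrite /F /G /= pi_lin.
Qed.

Lemma derive_slice1 (R : realType) (V W Z : normedModType R) (f : V * W -> Z)
    (u a : V) (w : W) :
  'D_a (fun u => f (u, w)) u = 'D_(a, 0) f (u, w).
Proof.
rewrite /derive; set F := (X in _ = lim (X @ _)).
set G := (X in lim (X @ _) = _); suff -> : G = F by [].
apply/funext => h; rewrite /F /G /=.
by rewrite [(h *: (a, 0) + _)](_ : _ = (h *: a + u, w)) //;
  congr pair; rewrite /= scaler0 add0r.
Qed.

Lemma derive_slice2 (R : realType) (V W Z : normedModType R) (f : V * W -> Z)
    (u : V) (w b : W) :
  'D_b (fun w => f (u, w)) w = 'D_(0, b) f (u, w).
Proof.
rewrite /derive; set F := (X in _ = lim (X @ _)).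
set G := (X in lim (X @ _) = _); suff -> : G = F by [].
apply/funext => h; rewrite /F /G /=.
by rewrite [(h *: (0, b) + _)](_ : _ = (u, h *: b + w)) //;
  congr pair; rewrite /= scaler0 add0r.
Qed.

(** A vector-valued map is differentiable as soon as its coordinates are. *)
Lemma diff_row (R : realType) (V : normedModType R) (m : nat)
    (F : V -> 'rV[R]_m) (a : V) :
  (forall j, differentiable (fun u => F u 0 j : R^o) a) ->
  differentiable F a /\
  forall h, 'd F a h = \row_j 'D_h (fun u => F u 0 j : R^o) a.
Proof.
move=> dF.
have E : F = \sum_(j < m) (fun u => F u 0 j *: delta_mx 0 j).
  apply/funext => u; rewrite fct_sumE; exact: row_sum_delta.
have dFa : differentiable F a.
  rewrite E; apply: differentiable_sum => j.
  exact: (@differentiableZl _ _ _ (fun u => F u 0 j) (delta_mx 0 j)).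
split=> // h; rewrite -deriveE // derive_mx; last exact: diff_derivable.
by apply/matrixP => i j; rewrite !mxE ord1.
Qed.

Lemma derive_coords (R : realType) (m n : nat) (f : 'rV[R]_m * 'rV[R]_n -> R^o)
    (p h : 'rV[R]_m * 'rV[R]_n) :
  differentiable f p ->
  'D_h f p = \sum_i h.1 0 i * 'D_(delta_mx 0 i, 0) f p
           + \sum_j h.2 0 j * 'D_(0, delta_mx 0 j) f p.
Proof.
move=> df.
have hE : h = \sum_i h.1 0 i *: (delta_mx 0 i, 0) + \sum_j h.2 0 j *: (0, delta_mx 0 j).
  case: h => h1 h2 /=; rewrite {1}(row_sum_delta h1) {1}(row_sum_delta h2).
  have sumE (I : finType) (F : I -> 'rV[R]_m * 'rV[R]_n) :
      \sum_i F i = (\sum_i (F i).1, \sum_i (F i).2).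
    by elim/big_rec3 : _ => // i x y z _ ->; case: (F i).
  rewrite !sumE /=; congr pair; rewrite /=.
    by rewrite [X in _ + X]big1 ?addr0 // => j _; rewrite scaler0.
  by rewrite [X in X + _]big1 ?add0r // => j _; rewrite scaler0.
rewrite !deriveE // {1}hE linearD !linear_sum /=; congr (_ + _).
  by apply: eq_bigr => i _; rewrite linearZ deriveE.
by apply: eq_bigr => i _; rewrite linearZ deriveE.
Qed.

(** * Blocks of the Hessian of a function of two vectors *)

Section SecondDerivative.
Context (R : realType) (m : nat).
Implicit Types (f : 'rV[R]_m * 'rV[R]_m -> R^o) (p h : 'rV[R]_m * 'rV[R]_m)
  (U : set ('rV[R]_m * 'rV[R]_m)).

(** The block d_1 d_1 f of the Hessian of [f] at [p]. *)
Definition hess11 f p : 'M[R]_m :=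
  \matrix_(i, j) 'D_(delta_mx 0 i, 0) ('D_(delta_mx 0 j, 0) f) p.
(** The block d_1 d_2 f, with rows indexed by the first variable; d_2 d_1 f is its
transpose when [f] is of class C^2. *)
Definition hess12 f p : 'M[R]_m :=
  \matrix_(i, j) 'D_(delta_mx 0 i, 0) ('D_(0, delta_mx 0 j) f) p.
(** The block d_2 d_2 f. *)
Definition hess22 f p : 'M[R]_m :=
  \matrix_(i, j) 'D_(0, delta_mx 0 i) ('D_(0, delta_mx 0 j) f) p.

Lemma derive_partial1 U f p h j : open U -> U p -> is_Ck 2 U f ->
  'D_h ('D_(delta_mx 0 j, 0) f) p = (h.1 *m hess11 f p + h.2 *m (hess12 f p)^T) 0 j.
Proof.
move=> Uo Up Cf; have [_ d2] := Cf.
rewrite derive_coords; last by case: (d2 (delta_mx 0 j, 0)) => /(_ p Up).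
rewrite [RHS]mxE [X in _ = X + _]mxE [X in _ = _ + X]mxE.
congr (_ + _).
  by apply: eq_bigr => i _; rewrite [hess11 _ _ _ _]mxE.
apply: eq_bigr => i _; rewrite [(hess12 _ _)^T _ _]mxE [hess12 _ _ _ _]mxE.
by rewrite (derive2_sym (0, delta_mx 0 i) (delta_mx 0 j, 0) Uo Up Cf).
Qed.

Lemma derive_partial2 U f p h j : open U -> U p -> is_Ck 2 U f ->
  'D_h ('D_(0, delta_mx 0 j) f) p = (h.1 *m hess12 f p + h.2 *m hess22 f p) 0 j.
Proof.
move=> Uo Up Cf; have [_ d2] := Cf.
rewrite derive_coords; last by case: (d2 (0, delta_mx 0 j)) => /(_ p Up).
rewrite [RHS]mxE [X in _ = X + _]mxE [X in _ = _ + X]mxE.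
congr (_ + _); apply: eq_bigr => i _.
  by rewrite [hess12 _ _ _ _]mxE.
by rewrite [hess22 _ _ _ _]mxE.
Qed.

(** The second differential of [f] as a bilinear form, block by block. *)
Lemma second_coords U f p h k : open U -> U p -> is_Ck 2 U f ->
  'D_h ('D_k f) p =
    ((h.1 *m hess11 f p + h.2 *m (hess12 f p)^T) *m k.1^T
     + (h.1 *m hess12 f p + h.2 *m hess22 f p) *m k.2^T) 0 0.
Proof.
move=> Uo Up Cf; have [_ d2] := Cf.
rewrite (derive2_sym h k Uo Up Cf) derive_coords; last first.
  by case: (d2 h) => /(_ p Up).
rewrite [RHS]mxE [X in _ = X + _]mxE [X in _ = _ + X]mxE.
congr (_ + _); apply: eq_bigr => j _.
  rewrite (derive2_sym (delta_mx 0 j, 0) h Uo Up Cf).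
  rewrite (derive_partial1 h j Uo Up Cf).
  by rewrite [X in _ = _ * X]mxE mulrC.
rewrite (derive2_sym (0, delta_mx 0 j) h Uo Up Cf).
rewrite (derive_partial2 h j Uo Up Cf).
by rewrite [X in _ = _ * X]mxE mulrC.
Qed.

Lemma delta_mulmx_delta (A : 'M[R]_m) (i j : 'I_m) :
  ((delta_mx 0 i : 'rV_m) *m A *m (delta_mx 0 j : 'rV_m)^T) 0 0 = A i j :> R.
Proof. by rewrite -rowE trmx_delta -colE !mxE. Qed.

(** The same bilinear form on vectors whose two halves are multiples of the same
basis vector. *)
Lemma second_delta U f p (s t s' t' : R) i j : open U -> U p -> is_Ck 2 U f ->
  'D_(s *: delta_mx 0 i, t *: delta_mx 0 i)
     ('D_(s' *: delta_mx 0 j, t' *: delta_mx 0 j) f) p =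
  s * s' * hess11 f p i j + s * t' * hess12 f p i j
  + t * s' * hess12 f p j i + t * t' * hess22 f p i j.
Proof.
move=> Uo Up Cf; rewrite (second_coords _ _ Uo Up Cf) /=.
move: (hess11 f p) (hess12 f p) (hess22 f p) => A B D.
have trZ (c : R) (v : 'rV[R]_m) : (c *: v)^T = c *: v^T.
  by apply/matrixP => k l; rewrite !mxE.
have E c (X : 'M[R]_1) : (c *: X) 0 0 = c * X 0 0 by rewrite mxE.
have F (X Y : 'M[R]_1) : (X + Y) 0 0 = X 0 0 + Y 0 0 by rewrite mxE.
rewrite !trZ -!scalemxAr !mulmxDl -!scalemxAl F !E !F !E !delta_mulmx_delta.
rewrite [B^T _ _]mxE; ring.
Qed.

End SecondDerivative.

(** * The Hessian of a cyclic sum *)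

(** The first derivative of the sum is computed on a neighbourhood of [u], which is
where the finitely many conditions on [pi i v] hold simultaneously. *)
Lemma derive2_sum_comp (R : realType) (V W : normedModType R) (n : nat)
    (f : 'I_n -> W -> R^o) (pi : 'I_n -> V -> W) (U : 'I_n -> set W) (u a b : V) :
  (forall i, linear (pi i)) -> (forall i v, `|pi i v| <= `|v|) ->
  (forall i, open (U i)) -> (forall i, U i (pi i u)) ->
  (forall i, is_Ck 2 (U i) (f i)) ->
  'D_a ('D_b (\sum_(i < n) (f i \o pi i))) u =
  \sum_(i < n) 'D_(pi i a) ('D_(pi i b) (f i)) (pi i u).
Proof.
move=> pi_lin pi_short Uo Uu Cf.
have nU : \forall v \near u, forall i, U i (pi i v).
  apply: filter_forall => i.
  apply: (nonexpansive_linear_continuous (pi_lin i) (pi_short i)).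
  exact: open_nbhs_nbhs.
pose g i : V -> R^o := ('D_(pi i b) (f i)) \o pi i.
have E : \forall v \near u,
    'D_b (\sum_(i < n) (f i \o pi i)) v = (\sum_(i < n) g i) v.
  move: nU; apply: filterS => v Uv.
  rewrite derive_sum; last first.
    move=> i; apply: (derivable_comp_linear (pi_lin i)); apply: diff_derivable.
    by have [df _] := Cf i; exact: df (Uv i).
  rewrite fct_sumE; apply: eq_bigr => i _.
  by rewrite (derive_comp_linear (f i) v b (pi_lin i)).
rewrite (near_eq_derive a E) derive_sum; last first.
  move=> i; apply: (derivable_comp_linear (pi_lin i)); apply: diff_derivable.
  by have [_ d2] := Cf i; have [df _] := d2 (pi i b); exact: df (Uu i).
by apply: eq_bigr => i _; rewrite (derive_comp_linear _ u a (pi_lin i)).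
Qed.

Lemma sum_cyclic_delta (R : pzRingType) (n : nat) (k l : 'I_n)
    (A B B' D : 'I_n -> R) :
  \sum_q ((q == k)%:R * (q == l)%:R * A q + (q == k)%:R * (ordS q == l)%:R * B q
     + (ordS q == k)%:R * (q == l)%:R * B' q
     + (ordS q == k)%:R * (ordS q == l)%:R * D q) =
  (A k + D (ord_pred k)) *+ (l == k) + B k *+ (l == ordS k) + B' l *+ (k == ordS l).
Proof.
have ordS_eq q r : (ordS q == r :> 'I_n) = (q == ord_pred r).
  by rewrite -[r in LHS]ord_predK (inj_eq (@ordS_inj n)).
have pick (F : 'I_n -> R) r : \sum_q (q == r)%:R * F q = F r.
  rewrite (bigD1 r) //= eqxx mul1r big1 ?addr0 // => q /negPf ->.
  by rewrite mul0r.
rewrite !big_split /=.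
under eq_bigr do rewrite -mulrA.
under [X in _ + X + _ + _]eq_bigr do rewrite -mulrA.
under [X in _ + _ + X + _]eq_bigr do rewrite -!natrM mulnC natrM -mulrA.
under [X in _ + _ + _ + X]eq_bigr do rewrite ordS_eq -mulrA.
rewrite !pick ord_predK [ordS k == l]eq_sym [ordS l == k]eq_sym [k == l]eq_sym.
rewrite !mulr_natl mulrnDl -!addrA; congr (_ + _).
by rewrite addrA addrC.
Qed.

Section CyclicProjection.
Context (R : realType) (n m : nat).

(** The pair of consecutive blocks (u_i, u_(i+1)) of a vector with [n] blocks, with
u_n = u_0. *)
Definition cyclic_proj (i : 'I_n) (u : 'rV[R]_(n * m)) : 'rV[R]_m * 'rV[R]_m :=
  (row i (vec_mx u), row (ordS i) (vec_mx u)).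

Lemma cyclic_proj_linear i : linear (cyclic_proj i).
Proof. by move=> k u v; congr pair; apply/rowP => j; rewrite !mxE. Qed.

Lemma cyclic_proj_nonexpansive i u : `|cyclic_proj i u| <= `|u|.
Proof.
have E k : `|row k (vec_mx u)| <= `|u|.
  rewrite [leLHS]/Num.Def.normr /= mx_normrE.
  by apply: bigmax_le => // -[j l] _; rewrite !mxE le_mx_coord.
by rewrite prod_normE /= ge_max !E.
Qed.

Lemma cyclic_proj_delta i k j :
  cyclic_proj i (delta_mx 0 (mxvec_index k j)) =
  ((i == k)%:R *: delta_mx 0 j, (ordS i == k)%:R *: delta_mx 0 j).
Proof.
rewrite /cyclic_proj vec_mx_delta; congr pair; apply/rowP => l;
  by rewrite !mxE eqxx andTb -natrM mulnb.
Qed.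

(** The three terms are added up, rather than placed in disjoint blocks, so that the
formula stays true for n = 1 and n = 2, where block positions coincide. *)
Lemma hessian_cyclic_blocks (f : 'I_n -> 'rV[R]_m * 'rV[R]_m -> R^o)
    (U : 'I_n -> set ('rV[R]_m * 'rV[R]_m)) (u : 'rV[R]_(n * m))
    (k l : 'I_n) (i j : 'I_m) :
  (forall i, open (U i)) -> (forall i, U i (cyclic_proj i u)) ->
  (forall i, is_Ck 2 (U i) (f i)) ->
  let p i := cyclic_proj i u in
  hessian (\sum_(i < n) (f i \o cyclic_proj i) : _ -> R^o) u
    (mxvec_index k i) (mxvec_index l j) =
  (hess11 (f k) (p k) + hess22 (f (ord_pred k)) (p (ord_pred k))) i j *+ (l == k)
  + hess12 (f k) (p k) i j *+ (l == ordS k)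
  + hess12 (f l) (p l) j i *+ (k == ordS l).
Proof.
move=> Uo Uu Cf p; rewrite mxE.
rewrite (derive2_sum_comp _ _ cyclic_proj_linear cyclic_proj_nonexpansive Uo Uu Cf).
under eq_bigr => q _.
  rewrite !cyclic_proj_delta (second_delta _ _ _ _ _ _ (Uo q) (Uu q) (Cf q)).
  over.
rewrite (sum_cyclic_delta k l (fun q => hess11 (f q) (p q) i j)
  (fun q => hess12 (f q) (p q) i j) (fun q => hess12 (f q) (p q) j i)
  (fun q => hess22 (f q) (p q) i j)).
by rewrite [in RHS]mxE.
Qed.

End CyclicProjection.

(** * The Lagrangian map in charts and its differential *)

(** The differential of the left-hand side d_2 f(u_1, u_2) + d_1 g(u_2, w) of the
discrete Euler-Lagrange equation for the two consecutive Lagrangians [f] and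
[g], as a function of ((u_1, u_2), w). *)
Lemma diff_discrete_EL (R : realType) (m : nat)
    (f g : 'rV[R]_m * 'rV[R]_m -> R^o) (U U' : set ('rV[R]_m * 'rV[R]_m))
    (u : 'rV[R]_m * 'rV[R]_m) (w : 'rV[R]_m) :
  open U -> U u -> is_Ck 2 U f -> open U' -> U' (u.2, w) -> is_Ck 2 U' g ->
  let G := fun t : ('rV[R]_m * 'rV[R]_m) * 'rV[R]_m =>
    \row_j ('D_(0, delta_mx 0 j) f t.1 + 'D_(delta_mx 0 j, 0) g (t.1.2, t.2)) in
  differentiable G (u, w) /\
  forall h z, 'd G (u, w) (h, z) =
    h.1 *m hess12 f u + h.2 *m (hess22 f u + hess11 g (u.2, w))
    + z *m (hess12 g (u.2, w))^T.
Proof.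
move=> Uo Uu Cf Uo' Uu' Cg G.
pose E1 j : 'rV[R]_m * 'rV[R]_m := (0, delta_mx 0 j).
pose E2 j : 'rV[R]_m * 'rV[R]_m := (delta_mx 0 j, 0).
pose T := (('rV[R]_m * 'rV[R]_m) * 'rV[R]_m)%type.
pose p1 (t : T) := t.1; pose p2 (t : T) := (t.1.2, t.2).
have p1_lin : linear p1 by [].
have p2_lin : linear p2 by [].
have p1_short t : `|p1 t| <= `|t| by rewrite [leRHS]prod_normE le_max lexx.
have p2_short t : `|p2 t| <= `|t|.
  case: t => [[a b] z]; rewrite /p2 !prod_normE /= ge_max.
  by rewrite le_max le_max lexx orbT le_max lexx orbT.
have [_ d2f] := Cf; have [_ d2g] := Cg.
have df j : differentiable ('D_(E1 j) f) (p1 (u, w)).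
  by have [d _] := d2f (E1 j); exact: d.
have dg j : differentiable ('D_(E2 j) g) (p2 (u, w)).
  by have [d _] := d2g (E2 j); exact: d.
have GE j : (fun t => G t 0 j : R^o) = ('D_(E1 j) f \o p1) + ('D_(E2 j) g \o p2).
  by apply/funext => t; rewrite /G mxE.
have dG j : differentiable (fun t => G t 0 j : R^o) (u, w).
  rewrite GE; apply: differentiableD; apply: differentiable_comp => //.
    by have [] := nonexpansive_linear_diff (u, w) p1_lin p1_short.
  by have [] := nonexpansive_linear_diff (u, w) p2_lin p2_short.
have [dGG GD] := diff_row dG; split=> // h z; rewrite GD.
apply/rowP => j; rewrite [LHS]mxE GE deriveD; last first.
- by apply: (derivable_comp_linear p2_lin); apply: diff_derivable.
- by apply: (derivable_comp_linear p1_lin); apply: diff_derivable.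
rewrite (derive_comp_linear _ (u, w) (h, z) p1_lin).
rewrite (derive_comp_linear _ (u, w) (h, z) p2_lin).
rewrite (derive_partial2 h j Uo Uu Cf) (derive_partial1 (h.2, z) j Uo' Uu' Cg) /=.
have aX (X Y : 'rV[R]_m) : X 0 j + Y 0 j = (X + Y) 0 j by rewrite mxE.
by rewrite aX mulmxDr !addrA.
Qed.

Lemma pair_map_continuous (X Y X' Y' : topologicalType) (f : X -> X') (g : Y -> Y')
    (u : X * Y) :
  {for u.1, continuous f} -> {for u.2, continuous g} ->
  {for u, continuous (fun v : X * Y => (f v.1, g v.2))}.
Proof.
case: u => a b cf cg A [[A1 A2] [/= n1 n2] sA].
exists (f @^-1` A1, g @^-1` A2); first by split; [exact: cf | exact: cg].
by move=> [v1 v2] [/= h1 h2]; apply: (sA (f v1, g v2)).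
Qed.

Section Dynamics.
Context (R : realType) (m : nat) (M : topologicalType).
Context (S : smooth_manifold R m M) (L : M -> M -> R^o).
Context (x : int -> M) (T : int -> M * M -> M * M) (c : int -> chart R m M).
Context (L_smooth : smooth_lagrangian S L) (T_map : lagrangian_map S L x T)
  (c_at : forall i, chart_at S (x i) (c i)).

(** Indices are shifted by one: the local data number [k] lives in the charts around
x_(k+1) and x_(k+2), so that the trajectory starts at (x_1, x_2) for k = 0. *)
Definition local_lagrangian (k : nat) (u : 'rV[R]_m * 'rV[R]_m) : R^o :=
  L (chart_inv (c k.+1%:Z) u.1) (chart_inv (c k.+2%:Z) u.2).

(** The open set where [local_lagrangian k] is the Lagrangian read in charts. *)
Definition local_dom (k : nat) : set ('rV[R]_m * 'rV[R]_m) :=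
  chart_im (c k.+1%:Z) `*` chart_im (c k.+2%:Z).

(** The coordinates of (x_(k+1), x_(k+2)). *)
Definition local_pt (k : nat) : 'rV[R]_m * 'rV[R]_m :=
  (chart_map (c k.+1%:Z) (x k.+1%:Z), chart_map (c k.+2%:Z) (x k.+2%:Z)).

(** The point of M x M with given coordinates in the charts number [k]. *)
Definition unchart (k : nat) (u : 'rV[R]_m * 'rV[R]_m) : M * M :=
  (chart_inv (c k.+1%:Z) u.1, chart_inv (c k.+2%:Z) u.2).

(** The coordinates of a point of M x M in the charts number [k]. *)
Definition tochart (k : nat) (q : M * M) : 'rV[R]_m * 'rV[R]_m :=
  (chart_map (c k.+1%:Z) q.1, chart_map (c k.+2%:Z) q.2).

Lemma chart_imK (d : chart R m M) u : chart_im d u ->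
  chart_dom d (chart_inv d u) /\ chart_map d (chart_inv d u) = u.
Proof. by case=> y dy <-; rewrite chart_mapK. Qed.

Lemma local_dom_open k : open (local_dom k).
Proof.
rewrite openE => u [u1 u2].
exists (chart_im (c k.+1%:Z), chart_im (c k.+2%:Z)) => //.
by split; apply: open_nbhs_nbhs; split => //; exact: chart_im_open.
Qed.

Lemma local_dom_pt k : local_dom k (local_pt k).
Proof.
have [_ d1] := c_at k.+1%:Z; have [_ d2] := c_at k.+2%:Z.
by split; [exists (x k.+1%:Z) | exists (x k.+2%:Z)].
Qed.

Lemma local_lagrangian_smooth k j : is_Ck j (local_dom k) (local_lagrangian k).
Proof.
have [d1 _] := c_at k.+1%:Z; have [d2 _] := c_at k.+2%:Z.
exact: (L_smooth d1 d2).
Qed.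

Lemma unchart_pt k : unchart k (local_pt k) = (x k.+1%:Z, x k.+2%:Z).
Proof.
have [_ d1] := c_at k.+1%:Z; have [_ d2] := c_at k.+2%:Z.
by rewrite /unchart /= !chart_mapK.
Qed.

Lemma unchart_continuous k : {for local_pt k, continuous (unchart k)}.
Proof.
have [u1 u2] := local_dom_pt k.
have c1 : {for (local_pt k).1, continuous (chart_inv (c k.+1%:Z))}.
  exact: chart_inv_continuous.
have c2 : {for (local_pt k).2, continuous (chart_inv (c k.+2%:Z))}.
  exact: chart_inv_continuous.
exact: pair_map_continuous c1 c2.
Qed.

Lemma tochart_continuous k : {for (x k.+1%:Z, x k.+2%:Z), continuous (tochart k)}.
Proof.
have [_ d1] := c_at k.+1%:Z; have [_ d2] := c_at k.+2%:Z.
have c1 : {for x k.+1%:Z, continuous (chart_map (c k.+1%:Z))}.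
  exact: chart_map_continuous.
have c2 : {for x k.+2%:Z, continuous (chart_map (c k.+2%:Z))}.
  exact: chart_map_continuous.
exact: (@pair_map_continuous _ _ _ _ _ _ (x k.+1%:Z, x k.+2%:Z) c1 c2).
Qed.

Lemma near_unchart_tochart k :
  \forall q \near (x k.+1%:Z, x k.+2%:Z), unchart k (tochart k q) = q.
Proof.
have [_ d1] := c_at k.+1%:Z; have [_ d2] := c_at k.+2%:Z.
have n1 : \forall q \near (x k.+1%:Z, x k.+2%:Z), chart_dom (c k.+1%:Z) q.1.
  apply: cvg_fst; apply: open_nbhs_nbhs; split => //; exact: chart_dom_open.
have n2 : \forall q \near (x k.+1%:Z, x k.+2%:Z), chart_dom (c k.+2%:Z) q.2.
  apply: cvg_snd; apply: open_nbhs_nbhs; split => //; exact: chart_dom_open.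
move: n1 n2; apply: filterS2 => -[q1 q2] /= h1 h2.
by rewrite /unchart /tochart /= !chart_mapK.
Qed.

Lemma lagrangian_branchP (k : nat) :
  [/\ T k.+1%:Z (x k.+1%:Z, x k.+2%:Z) = (x k.+2%:Z, x k.+3%:Z),
      {for (x k.+1%:Z, x k.+2%:Z), continuous (T k.+1%:Z)} &
      \forall p \near (x k.+1%:Z, x k.+2%:Z),
        (T k.+1%:Z p).1 = p.2 /\ discrete_EL S L p.1 p.2 (T k.+1%:Z p).2].
Proof.
have := T_map k.+1%:Z.
have -> : k.+1%:Z + 1 = k.+2%:Z by lia.
by have -> : k.+1%:Z + 2 = k.+3%:Z by lia.
Qed.

(** The branch of the Lagrangian map near (x_(k+1), x_(k+2)), read in the charts
number [k] at the source and [k] + 1 at the target. *)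
Definition local_map (k : nat) (u : 'rV[R]_m * 'rV[R]_m) : 'rV[R]_m * 'rV[R]_m :=
  tochart k.+1 (T k.+1%:Z (unchart k u)).

Context (twist_unit : forall k,
  hess12 (local_lagrangian k) (local_pt k) \in unitmx).

(** The differential of the Lagrangian map solves the linearised discrete
Euler-Lagrange equation. *)
Lemma local_map_diff k :
  differentiable (local_map k) (local_pt k) /\
  forall h0 h1 h2 : 'rV[R]_m,
    h0 *m hess12 (local_lagrangian k) (local_pt k)
    + h1 *m (hess22 (local_lagrangian k) (local_pt k)
             + hess11 (local_lagrangian k.+1) (local_pt k.+1))
    + h2 *m (hess12 (local_lagrangian k.+1) (local_pt k.+1))^T = 0 ->
    'd (local_map k) (local_pt k) (h0, h1) = (h1, h2).
Proof.
have [Tpt Tc TEL] := lagrangian_branchP k.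
pose w u := chart_map (c k.+3%:Z) (T k.+1%:Z (unchart k u)).2.
have TU : (T k.+1%:Z \o unchart k) @ local_pt k --> (x k.+2%:Z, x k.+3%:Z).
  rewrite -Tpt; apply: cvg_comp; last exact: Tc.
  by have := @unchart_continuous k; rewrite /prop_for /continuous_at unchart_pt.
have w_pt : w (local_pt k) = chart_map (c k.+3%:Z) (x k.+3%:Z).
  by rewrite /w unchart_pt Tpt.
have cw : {for local_pt k, continuous w}.
  rewrite /prop_for /continuous_at w_pt.
  have := @tochart_continuous k.+1; rewrite /prop_for /continuous_at => ct.
  have := cvg_comp _ _ TU ct.
  by move/(cvg_comp _ _)/(_ (@cvg_snd _ _ _ _ _)).
have nU : \forall u \near local_pt k, local_dom k u.
  by apply: open_nbhs_nbhs; split; [exact: local_dom_open | exact: local_dom_pt].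
have nEL : \forall u \near local_pt k,
    (T k.+1%:Z (unchart k u)).1 = (unchart k u).2 /\
    discrete_EL S L (unchart k u).1 (unchart k u).2 (T k.+1%:Z (unchart k u)).2.
  have := @unchart_continuous k; rewrite /prop_for /continuous_at unchart_pt.
  by move=> uc; exact: uc TEL.
have nT : \forall u \near local_pt k,
    unchart k.+1 (local_map k u) = T k.+1%:Z (unchart k u).
  exact: TU (near_unchart_tochart k.+1).
pose G := fun t : ('rV[R]_m * 'rV[R]_m) * 'rV[R]_m =>
    \row_j ('D_(0, delta_mx 0 j) (local_lagrangian k) t.1
            + 'D_(delta_mx 0 j, 0) (local_lagrangian k.+1) (t.1.2, t.2)).
have nG : \forall u \near local_pt k, G (u, w u) = 0.
  near=> u.
  have [u1 u2] : local_dom k u by near: u.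
  have [_ EL] : (T k.+1%:Z (unchart k u)).1 = (unchart k u).2 /\
    discrete_EL S L (unchart k u).1 (unchart k u).2 (T k.+1%:Z (unchart k u)).2.
    by near: u.
  have Tu : unchart k.+1 (local_map k u) = T k.+1%:Z (unchart k u) by near: u.
  have [u2d u2K] := chart_imK u2.
  have [c2S _] := c_at k.+2%:Z.
  rewrite -(EL (c k.+2%:Z)) //.
  apply/rowP => j; rewrite !mxE /= u2K; congr (_ + _).
    exact: esym (derive_slice2 (local_lagrangian k) u.1 u.2 (delta_mx 0 j)).
  rewrite -(derive_slice1 (local_lagrangian k.+1) u.2 (delta_mx 0 j) (w u)).
  rewrite /local_lagrangian /=.
  have -> // : chart_inv (c k.+3%:Z) (w u) = (T k.+1%:Z (unchart k u)).2.
  by rewrite -[in RHS]Tu.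
have pt_w : ((local_pt k).2, w (local_pt k)) = local_pt k.+1.
  by rewrite w_pt.
have [dG GD] := @diff_discrete_EL R m (local_lagrangian k) (local_lagrangian k.+1)
  (local_dom k) (local_dom k.+1) (local_pt k) (w (local_pt k))
  (@local_dom_open k) (@local_dom_pt k) (@local_lagrangian_smooth k 2)
  (@local_dom_open k.+1) (eq_ind_r (local_dom k.+1) (@local_dom_pt k.+1) pt_w)
  (@local_lagrangian_smooth k.+1 2).
rewrite -/G pt_w in dG GD.
have Bu : (hess12 (local_lagrangian k.+1) (local_pt k.+1))^T \in unitmx.
  by rewrite unitmx_tr.
have GB z : 'd G (local_pt k, w (local_pt k)) (0, z) =
    z *m (hess12 (local_lagrangian k.+1) (local_pt k.+1))^T.
  by rewrite GD /= !mul0mx !add0r.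
have [dw wD] := implicit_diff dG cw nG Bu GB.
have loc : \forall u \near local_pt k, (u.2, w u) = local_map k u.
  near=> u.
  have [u1 u2] : local_dom k u by near: u.
  have [T1 _] : (T k.+1%:Z (unchart k u)).1 = (unchart k u).2 /\
    discrete_EL S L (unchart k u).1 (unchart k u).2 (T k.+1%:Z (unchart k u)).2.
    by near: u.
  rewrite /local_map /tochart T1; congr pair.
  by have [_ ->] := chart_imK u2.
have snd_lin : linear (fun u : 'rV[R]_m * 'rV[R]_m => u.2) by [].
have snd_short (u : 'rV[R]_m * 'rV[R]_m) : `|u.2| <= `|u|.
  by rewrite [leRHS]prod_normE le_max lexx orbT.
have [dsnd sndD] := nonexpansive_linear_diff (local_pt k) snd_lin snd_short.
have [dl lD] := near_eq_diff loc (differentiable_pair dsnd dw).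
split; first exact: dl.
move=> h0 h1 h2 E.
have wE : 'd w (local_pt k) (h0, h1) = h2.
  have := wD (h0, h1); rewrite GD.
  move: ('d w _ _) => z zE.
  have /addrI := etrans zE (esym E).
  exact: (can_inj (mulmxK Bu)).
have PD := congr1 (fun f => f (h0, h1)) (diff_pair dsnd dw).
have sndE := congr1 (fun f => f (h0, h1)) sndD.
have mapE := congr1 (fun f => f (h0, h1)) lD.
exact: etrans mapE (etrans PD (congr2 pair sndE wE)).
Unshelve. all: by end_near. Qed.

(** The composite of the first [k] branches, read in the charts number 0 and [k]. *)
Definition local_iter (k : nat) (u : 'rV[R]_m * 'rV[R]_m) : 'rV[R]_m * 'rV[R]_m :=
  tochart k (lagrangian_iter T k (unchart 0 u)).

(** The differential of the iterate transports the solutions [xi] of the linearised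
equation. *)
Lemma local_iter_diff (xi : nat -> 'rV[R]_m) k :
  (forall k, xi k *m hess12 (local_lagrangian k) (local_pt k)
    + xi k.+1 *m (hess22 (local_lagrangian k) (local_pt k)
             + hess11 (local_lagrangian k.+1) (local_pt k.+1))
    + xi k.+2 *m (hess12 (local_lagrangian k.+1) (local_pt k.+1))^T = 0) ->
  differentiable (local_iter k) (local_pt 0) /\
  'd (local_iter k) (local_pt 0) (xi 0%N, xi 1%N) = (xi k, xi k.+1).
Proof.
move=> xiE.
(* Continuity is carried along: it keeps the iterates in the chart domains near the
   base point. *)
suff [] : (lagrangian_iter T k \o unchart 0) @ local_pt 0 --> (x k.+1%:Z, x k.+2%:Z) /\
  lagrangian_iter T k (unchart 0 (local_pt 0)) = (x k.+1%:Z, x k.+2%:Z) /\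
  differentiable (local_iter k) (local_pt 0) /\
  'd (local_iter k) (local_pt 0) (xi 0%N, xi 1%N) = (xi k, xi k.+1).
  by move=> _ [].
elim: k => [|k [IHc [IHpt [IHd IHD]]]].
  have uc := @unchart_continuous 0.
  rewrite /prop_for /continuous_at unchart_pt in uc.
  split=> //; split; first exact: unchart_pt.
  have id_lin : linear (fun u : 'rV[R]_m * 'rV[R]_m => u) by [].
  have id_short (u : 'rV[R]_m * 'rV[R]_m) : `|u| <= `|u| by [].
  have [did idD] := nonexpansive_linear_diff (local_pt 0) id_lin id_short.
  have loc : \forall u \near local_pt 0, u = local_iter 0 u.
    have : \forall u \near local_pt 0, local_dom 0 u.
      by apply: open_nbhs_nbhs; split; [exact: local_dom_open | exact: local_dom_pt].
    apply: filterS => -[u1 u2] [d1 d2]; rewrite /local_iter /tochart /=.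
    by have [_ ->] := chart_imK d1; have [_ ->] := chart_imK d2.
  have [dl lD] := near_eq_diff loc did.
  have lE := congr1 (fun f => f (xi 0%N, xi 1%N)) lD.
  have idE := congr1 (fun f => f (xi 0%N, xi 1%N)) idD.
  exact: conj dl (etrans lE idE).
have [Tpt Tc _] := lagrangian_branchP k.
have iter_pt : local_iter k (local_pt 0) = local_pt k by rewrite /local_iter IHpt.
have [dmap mapD] := local_map_diff k.
split.
  by rewrite -Tpt; exact: (cvg_comp _ _ IHc Tc).
split; first by rewrite /= IHpt Tpt.
have loc : \forall u \near local_pt 0,
    (local_map k \o local_iter k) u = local_iter k.+1 u.
  have : \forall u \near local_pt 0,
      unchart k (local_iter k u) = lagrangian_iter T k (unchart 0 u).
    exact: IHc (near_unchart_tochart k).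
  by apply: filterS => u E; rewrite /= /local_map E.
have mE := mapD _ _ _ (xiE k).
rewrite -iter_pt in dmap mE.
have [dl lD] := near_eq_diff loc (differentiable_comp IHd dmap).
have lE := congr1 (fun f => f (xi 0%N, xi 1%N)) lD.
have cE := congr1 (fun f => f (xi 0%N, xi 1%N)) (diff_comp IHd dmap).
rewrite -IHD in mE.
exact: conj dl (etrans lE (etrans cE mE)).
Qed.

End Dynamics.

(** * The Hessian of the action *)

Section ActionHessian.
Context (R : realType) (m n : nat) (M : topologicalType).
Context (S : smooth_manifold R m M) (L : M -> M -> R^o).
Context (x : int -> M) (c : int -> chart R m M).
Context (L_smooth : smooth_lagrangian S L)
  (c_at : forall i, chart_at S (x i) (c i))
  (x_per : forall i, x (i + n%:Z) = x i) (c_per : forall i, c (i + n%:Z) = c i).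

Local Notation ll := (local_lagrangian L c).
Local Notation pt := (local_pt x c).
Local Notation B k := (hess12 (ll k) (pt k)).

(** The twist matrix differentiates first in the first variable; the transposition
comes from its row index being that of the second variable. *)
Lemma twist_mxE k :
  twist_mx L (c k.+1%:Z) (c k.+2%:Z) (x k.+1%:Z) (x k.+2%:Z) = - (B k)^T.
Proof.
apply/matrixP => j i; rewrite [LHS]mxE [RHS]mxE [_^T _ _]mxE [hess12 _ _ _ _]mxE.
apply: (congr1 -%R).
have sym := derive2_sym (delta_mx 0 i, 0) (0, delta_mx 0 j)
  (@local_dom_open R m M c k) (@local_dom_pt R m M S x c c_at k)
  (@local_lagrangian_smooth R m M S L x c L_smooth c_at k 2).
rewrite sym.
have s2 := derive_slice2 ('D_(delta_mx 0 i, 0) (ll k)) (pt k).1 (pt k).2 (delta_mx 0 j).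
apply: etrans s2.
have s1 v := derive_slice1 (ll k) (pt k).1 (delta_mx 0 i) v.
exact: (congr1 (fun F : 'rV[R]_m -> R^o => 'D_(delta_mx 0 j) F (pt k).2) (funext s1)).
Qed.

Lemma local_lagrangian_per k : ll (k + n) = ll k.
Proof.
rewrite /local_lagrangian; have -> : (k + n).+1%:Z = k.+1%:Z + n%:Z by lia.
have -> : (k + n).+2%:Z = k.+2%:Z + n%:Z by lia.
by rewrite !c_per.
Qed.

Lemma local_pt_per k : pt (k + n)%N = pt k.
Proof.
rewrite /local_pt; have -> : (k + n).+1%:Z = k.+1%:Z + n%:Z by lia.
have -> : (k + n).+2%:Z = k.+2%:Z + n%:Z by lia.
by rewrite !c_per !x_per.
Qed.

Lemma chart_ordS (i : 'I_n) : c (ordS i).+1%:Z = c i.+2%:Z /\ x (ordS i).+1%:Z = x i.+2%:Z.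
Proof.
have per (A : Type) (F : int -> A) : (forall i, F (i + n%:Z) = F i) ->
    F (ordS i).+1%:Z = F i.+2%:Z.
  move=> Fp; apply: (@periodic_modn A n (fun k => F k.+1%:Z)) => k.
  by rewrite -[RHS]Fp; congr F; lia.
by rewrite !per.
Qed.

Lemma cyclic_proj_coords (i : 'I_n) : cyclic_proj i (coords n c x) = pt i.
Proof.
have [cE xE] := chart_ordS i.
rewrite /cyclic_proj /coords mxvecK /local_pt -cE -xE.
by congr pair; apply/rowP => j; rewrite !mxE.
Qed.

Lemma action_sum :
  action L c = \sum_(i < n) (ll i \o @cyclic_proj R n m i) :> ('rV[R]_(n * m) -> R^o).
Proof.
apply/funext => u; rewrite /action fct_sumE; apply: eq_bigr => i _.
by rewrite /= /local_lagrangian /cyclic_proj /=; have [-> _] := chart_ordS i.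
Qed.

(** The diagonal block k is a_k + d_(k-1); the index k - 1 is written (k + n).-1, which
represents it modulo [n] also for k = 0. *)
Lemma action_hessian_blocks (k l : 'I_n) (i j : 'I_m) :
  action_hessian L n c x (mxvec_index k i) (mxvec_index l j) =
  (hess11 (ll k) (pt k) + hess22 (ll (k + n).-1) (pt (k + n).-1)) i j *+ (l == k)
  + B k i j *+ (l == ordS k) + B l j i *+ (k == ordS l).
Proof.
have Uu (q : 'I_n) : local_dom c q (cyclic_proj q (coords n c x)).
  by rewrite cyclic_proj_coords; exact: (@local_dom_pt R m M S x c c_at q).
have := @hessian_cyclic_blocks R n m (fun q => ll q) (fun q => local_dom c q)
  (coords n c x) k l i j (fun q => @local_dom_open R m M c q) Uu
  (fun q => @local_lagrangian_smooth R m M S L x c L_smooth c_at q 2).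
rewrite -action_sum /action_hessian => ->; rewrite !cyclic_proj_coords.
have -> : ll (ord_pred k) = ll (k + n).-1 by exact: (periodic_modn local_lagrangian_per).
by have -> : pt (ord_pred k) = pt (k + n).-1 by exact: (periodic_modn local_pt_per).
Qed.

End ActionHessian.

Unset Implicit Arguments.
Set Strict Implicit.

Theorem corollary2p1 (R : realType) (m n : nat) (M : topologicalType)
    (S : smooth_manifold R m M) (L : M -> M -> R)
    (x : int -> M) (T : int -> M * M -> M * M) (c : int -> chart R m M)
    (n_gt0 : (0 < n)%N)
    (L_smooth : smooth_lagrangian S L)
    (x_traj : periodic_trajectory S L n x)
    (B_nondeg : forall i : int,
       \forall p \near (x i, x (i + 1)), twist_nondegenerate S L p.1 p.2)
    (T_map : lagrangian_map S L x T)
    (c_charts : periodic_charts S n x c)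
    (H_nondeg : \det (action_hessian L n c x) != 0)
    (sign_lt0 : twist_sign L n c x
                * (-1) ^+ (m + morse_index (action_hessian L n c x)) < 0) :
  exists2 rho : R, 1 < rho & real_multiplier n c x T rho.
Proof.
have [x_per _] := x_traj; have [c_at c_per] := c_charts.
pose b k := hess12 (local_lagrangian L c k) (local_pt x c k).
(* (k + n).-1 stands for k - 1 modulo [n], as k may be 0. *)
pose A k := hess11 (local_lagrangian L c k) (local_pt x c k)
  + hess22 (local_lagrangian L c (k + n).-1) (local_pt x c (k + n).-1).
have twE k : twist_mx L (c k.+1%:Z) (c k.+2%:Z) (x k.+1%:Z) (x k.+2%:Z) = - (b k)^T.
  exact: (twist_mxE L_smooth c_at).
have bU k : b k \in unitmx.
  have := nbhs_singleton (B_nondeg k.+1%:Z).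
  have -> : k.+1%:Z + 1 = k.+2%:Z by lia.
  move=> /(_ (c k.+1%:Z) (c k.+2%:Z) (c_at _) (c_at _)) /=.
  by rewrite twE -scaleN1r unitmxZ ?unitrN1 // unitmx_tr.
have bn k : b (k + n)%N = b k.
  by rewrite /b (local_lagrangian_per L c_per) (local_pt_per x_per c_per).
have An k : A (k + n)%N = A k.
  rewrite /A (local_lagrangian_per L c_per) (local_pt_per x_per c_per).
  have -> : (k + n + n).-1 = ((k + n).-1 + n)%N by lia.
  by rewrite (local_lagrangian_per L c_per) (local_pt_per x_per c_per).
have AS k : A k.+1 = hess22 (local_lagrangian L c k) (local_pt x c k)
    + hess11 (local_lagrangian L c k.+1) (local_pt x c k.+1).
  have e : (k.+1 + n).-1 = (k + n)%N by [].
  rewrite /A e (local_lagrangian_per L c_per) (local_pt_per x_per c_per).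
  exact: addrC.
have HE := action_hessian_blocks L_smooth c_at x_per c_per.
have sgn : \det (action_hessian L n c x) *
    ((-1) ^+ m * \prod_(k < n) \det (- b k)) < 0.
  move: sign_lt0; rewrite /twist_sign exprD -sgr_det_morse //.
  under eq_bigr do rewrite twE -linearN det_tr.
  rewrite -sgr_lt0 !sgrM sgr_id sgrX sgrN1 => h.
  rewrite -sgr_lt0 !sgrM sgrX sgrN1.
  move: h; rewrite sgr_id mulrCA; move: (Num.sg _) (Num.sg _) => s1 s2 h.
  by rewrite mulrCA [s1 * _]mulrC.
have [rho [xi rho1 [[q xiq] xi_per xiE]]] :=
  @cyclic_multiplier R n m A b _ n_gt0 An bn (fun k i l j => HE k l i j) sgn.
exists rho => //.
have xiE' k : xi k *m b k + xi k.+1 *m (hess22 (local_lagrangian L c k) (local_pt x c k)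
             + hess11 (local_lagrangian L c k.+1) (local_pt x c k.+1))
    + xi k.+2 *m (b k.+1)^T = 0.
  by rewrite -AS; exact: xiE.
have [dF DF] := local_iter_diff L_smooth T_map c_at bU n xiE'.
have c1 : c n.+1%:Z = c 1 by rewrite -(c_per 1); congr c; lia.
have c2 : c n.+2%:Z = c 2 by rewrite -(c_per 2); congr c; lia.
have retE : return_map n c T = local_iter T c n.
  by apply/funext => u; rewrite /return_map /local_iter /tochart c1 c2.
rewrite /real_multiplier retE; split; first exact: dF.
exists (xi 0%N, xi 1%N).
  (* A solution with xi_0 = xi_1 = 0 vanishes, the blocks b_k being invertible. *)
  apply: contra_neq xiq => -[z0 z1].
  suff : xi q = 0 /\ xi q.+1 = 0 by case.
  elim: q => [//|q [IH0 IH1]]; split=> //.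
  have := xiE q; rewrite IH0 IH1 !mul0mx !add0r => z.
  have bT : (b q.+1)^T \in unitmx by rewrite unitmx_tr.
  by rewrite -[LHS](mulmxK bT) z mul0mx.
apply: etrans DF _.
by rewrite -[n in xi n]add0n -[n in xi n.+1]add0n -addSn !xi_per.
Qed.
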